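(* Let $\mathcal V$ be a Borel set of closed subgroups of $S_\infty$ that is closed under conjugation in $S_\infty$. Suppose that for each $G\in\mathcal V$ we have a countably infinite set $\mathcal N_G$ of open subgroups of $G$ that forms a neighbourhood basis of $1$ in $G$. Suppose further that the relation $$\mathcal T=\{(G,U)\colon G\in\mathcal V \text{ and } U\in\mathcal N_G\}$$ is Borel, and that it is isomorphism invariant in the sense that, for all $G,H\in\mathcal V$, every topological group isomorphism $\phi\colon G\to H$ and every open subgroup $V$ of $G$, we have $V\in\mathcal N_G \Leftrightarrow \phi(V)\in\mathcal N_H$. Then: (i) The relation of topological isomorphism on $\mathcal V$ is Borel reducible to the relation of conjugacy (in $S_\infty$) of closed subgroups of $S_\infty$. Moreover, there is such a Borel reduction $G\mapsto\widehat G$ for which a permutation $\alpha\in S_\infty$ conjugating $\widehat G$ to $\widehat H$ can be obtained in a Borel way from a topological isomorphism $\phi\colon G\to H$, and vice versa, for $G,H\in\mathcal V$. (ii) In particular, the relation of topological isomorphism on $\mathcal V$ is classifiable by countable structures.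
   Context: $S_\infty$ is the Polish group of all permutations of $\omega$ with the topology of pointwise convergence. For a Polish space $X$, $\mathcal F(X)$ is the set of closed subsets of $X$, with the Effros Borel structure: the $\sigma$-algebra generated by the sets $\{D\in\mathcal F(X)\colon D\cap U\neq\emptyset\}$ for $U\subseteq X$ open. ''$\mathcal V$ is Borel'' means Borel as a subset of $\mathcal F(S_\infty)$; ''$\mathcal T$ is Borel'' means Borel as a subset of $\mathcal F(S_\infty)\times\mathcal F(S_\infty)$ (an open subgroup of a closed subgroup of $S_\infty$ is itself closed in $S_\infty$). For equivalence relations $E,F$ on standard Borel spaces $X,Y$, $E$ is Borel reducible to $F$ if there is a Borel function $f\colon X\to Y$ with $xEx'\Leftrightarrow f(x)Ff(x')$ for all $x,x'\in X$. An equivalence relation $E$ on $X$ is classifiable by countable structures if in a Borel way one can assign to $x\in X$ a countable structure $M_x$ in a fixed countable language (a point in the Polish space of structures with domain $\omega$) so that $xEx'\Leftrightarrow M_x\cong M_{x'}$. In (i), a topological isomorphism $\phi\colon G\to H$ is coded by its graph, an element of $\mathcal F(S_\infty\times S_\infty)$. ''Obtained in a Borel way, and vice versa'' means: there is a Borel function taking each triple $(G,H,\phi)$ with $G,H\in\mathcal V$ and $\phi\colon G\to H$ a topological isomorphism to some $\alpha\in S_\infty$ with $\alpha\widehat G\alpha^{-1}=\widehat H$; and there is a Borel function taking each triple $(G,H,\alpha)$ with $G,H\in\mathcal V$, $\alpha\in S_\infty$ and $\alpha\widehat G\alpha^{-1}=\widehat H$ to (the graph of) some topological isomorphism $\phi\colon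 G\to H$. *)

(* Defs.v *)
From HB Require Import structures.
From mathcomp Require Import all_boot all_order all_algebra.
From mathcomp Require Import all_classical all_reals all_analysis.

Set Implicit Arguments.
Unset Strict Implicit.
Unset Printing Implicit Defensive.

Local Open Scope classical_set_scope.

Section Borel_structures.

Definition Borel (T : ptopologicalType) := g_sigma_algebraType (@open T).

HB.instance Definition _ (T : ptopologicalType) := Pointed.on (Borel T).
HB.instance Definition _ (T : ptopologicalType) :=
  Measurable.copy (Borel T) (g_sigma_algebraType (@open T)).

Context (T : topologicalType).

Definition closed_sets := set_type [set D : set T | closed D].

HB.instance Definition _ := Choice.on closed_sets.
HB.instance Definition _ := isPointed.Build closed_sets
  (SigSub (mem_set (@closed0 T))).

Definition effros_system : set (set closed_sets) :=
  [set [set D | set_val D `&` U !=set0] | U in @open T].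

Definition Effros := g_sigma_algebraType effros_system.

HB.instance Definition _ := Pointed.on Effros.
HB.instance Definition _ :=
  Measurable.copy Effros (g_sigma_algebraType effros_system).

Definition effros_set (D : Effros) : set T := set_val (D : closed_sets).

End Borel_structures.

Coercion effros_set : Effros >-> set.

Section Borel_reductions.
Context (d1 d2 : measure_display).
Context (T1 : measurableType d1) (T2 : measurableType d2).

(* Borel for the trace on [D] of the Borel structure of [T1]. If [D] is Borel,
   this is [measurable_fun D f]; the latter is vacuous if [D] is not Borel. The
   values of [f] outside of [D] are irrelevant. *)
Definition borel_on (D : set T1) (f : T1 -> T2) :=
  forall B, measurable B ->
    exists2 A, measurable A & D `&` f @^-1` B = D `&` A.

Definition borel_reduction (X : set T1) (E : T1 -> T1 -> Prop)
    (Y : set T2) (F : T2 -> T2 -> Prop) (f : T1 -> T2) :=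
  [/\ borel_on X f, (forall x, X x -> Y (f x)) &
      forall x x', X x -> X x' -> (E x x' <-> F (f x) (f x'))].

Definition borel_reducible (X : set T1) (E : T1 -> T1 -> Prop)
    (Y : set T2) (F : T2 -> T2 -> Prop) :=
  exists f, borel_reduction X E Y F f.

End Borel_reductions.

Section Sinfty.

Definition Sinfty := set_type [set f : {ptws nat -> nat} | bijective f].

HB.instance Definition _ := Topological.on Sinfty.

Definition perm_fun (a : Sinfty) : nat -> nat := set_val a.

Lemma perm_fun_bij (a : Sinfty) : bijective (perm_fun a).
Proof. exact: set_mem (valP a). Qed.

Lemma perm_fun_inj (a b : Sinfty) : perm_fun a = perm_fun b -> a = b.
Proof. exact: val_inj. Qed.

Definition mk_perm (f : nat -> nat) (fbij : bijective f) : Sinfty :=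
  SigSub (mem_set (fbij : [set f : {ptws nat -> nat} | bijective f] f)).

Lemma inv_ex (f : nat -> nat) :
  bijective f -> exists g, cancel f g /\ cancel g f.
Proof. by case=> g fK gK; exists g. Qed.

Lemma inv_bij (f : nat -> nat) (fbij : bijective f) :
  bijective (projT1 (cid (inv_ex fbij))).
Proof. by case: cid => g [fK gK] /=; exists f. Qed.

Definition perm1 : Sinfty := mk_perm (@Bijective nat nat id id (frefl _) (frefl _)).

Definition permM (a b : Sinfty) : Sinfty :=
  mk_perm (bij_comp (perm_fun_bij a) (perm_fun_bij b)).

Definition permV (a : Sinfty) : Sinfty := mk_perm (inv_bij (perm_fun_bij a)).

Lemma permMA : associative permM.
Proof. by move=> a b c; exact: perm_fun_inj. Qed.

Lemma perm1M : left_id perm1 permM.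
Proof. by move=> a; exact: perm_fun_inj. Qed.

Lemma permM1 : right_id perm1 permM.
Proof. by move=> a; exact: perm_fun_inj. Qed.

Lemma permVM : left_inverse perm1 permV permM.
Proof.
move=> a; apply: perm_fun_inj; apply/funext => n.
exact: (projT2 (cid (inv_ex (perm_fun_bij a)))).1.
Qed.

Lemma permMV : right_inverse perm1 permV permM.
Proof.
move=> a; apply: perm_fun_inj; apply/funext => n.
exact: (projT2 (cid (inv_ex (perm_fun_bij a)))).2.
Qed.

HB.instance Definition _ :=
  isGroup.Build Sinfty permMA perm1M permM1 permVM permMV.
HB.instance Definition _ := isPointed.Build Sinfty (1%g : Sinfty).

End Sinfty.

Section Subgroups.

Definition is_subgroup (G : set Sinfty) := group_closed (mem G).

Definition closed_subgroups : set (Effros Sinfty) :=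
  [set G : Effros Sinfty | is_subgroup G].

Definition open_subgroup (G U : set Sinfty) :=
  [/\ is_subgroup U, U `<=` G & exists2 O : set Sinfty, open O & U = G `&` O].

(* [within G (nbhs 1) A] says that [A `&` G] is a neighbourhood of 1 in [G] *)
Definition nbhd_basis1 (G : set Sinfty) (B : set (set Sinfty)) :=
  forall A : set Sinfty,
    within G (nbhs (1%g : Sinfty)) A <-> exists2 U, B U & U `<=` A.

Definition conj_set (a : Sinfty) (G : set Sinfty) : set Sinfty :=
  [set (a * x * a^-1)%g | x in G].

Definition conjugate (G H : Effros Sinfty) :=
  exists a, conj_set a G = H.

Definition top_iso (G H : set Sinfty) (phi : Sinfty -> Sinfty) :=
  [/\ set_bij G H phi,
      {in G &, {morph phi : x y / (x * y)%g}},
      {within G, continuous phi} &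
      exists2 psi, {in G, cancel phi psi} & {within H, continuous psi}].

Definition top_isomorphic (G H : Effros Sinfty) := exists phi, top_iso G H phi.

Definition is_iso_graph (G H : set Sinfty) (D : set (Sinfty * Sinfty)) :=
  exists2 phi, top_iso G H phi & D = [set (x, phi x) | x in G].

End Subgroups.

Section Structures.

(* constants are function symbols of arity 0 *)
Record language := Language {
  rel_sym : countType;
  rel_arity : rel_sym -> nat;
  fun_sym : countType;
  fun_arity : fun_sym -> nat }.

(* structures with domain [nat], with the product of the discrete topologies *)
Definition structures (L : language) : Type :=
  (prod_topology (fun R : rel_sym L =>
     {ptws (rel_arity R).-tuple nat -> bool}) *
   prod_topology (fun f : fun_sym L =>
     {ptws (fun_arity f).-tuple nat -> nat}))%type.

HB.instance Definition _ (L : language) := Topological.on (structures L).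
HB.instance Definition _ (L : language) := isPointed.Build (structures L)
  (fun=> fun=> false, fun=> fun=> 0%N).

Definition struct_iso (L : language) (M N : structures L) :=
  exists s : nat -> nat, [/\ bijective s,
    (forall R (t : (rel_arity R).-tuple nat),
       M.1 R t = N.1 R (map_tuple s t)) &
    (forall f (t : (fun_arity f).-tuple nat),
       s (M.2 f t) = N.2 f (map_tuple s t))].

Definition classifiable_by_countable_structures d (T : measurableType d)
    (X : set T) (E : T -> T -> Prop) :=
  exists L : language,
    borel_reducible X E [set: Borel (structures L)] (@struct_iso L).

End Structures.

(* Main.v *)
Require Import Defs.
From HB Require Import structures.
From mathcomp Require Import all_boot all_order all_algebra.
From mathcomp Require Import all_classical all_reals all_analysis.

Set Implicit Arguments.
Unset Strict Implicit.
Unset Printing Implicit Defensive.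

Local Open Scope classical_set_scope.

(** A topological isomorphism between members of [V] can be read off from the
    action of each group [G] on the set of left cosets of the members of
    [N G], which is countably infinite because [N G] is and because an open
    subgroup of [G] has countably many cosets. As [N G] is a neighbourhood
    basis of 1, this action is faithful, and it identifies [G] as a topological
    group with a closed subgroup [hat G] of the symmetric group of the set of
    cosets, hence of [Sinfty] once the cosets are enumerated without repetition
    ([rho_continuous], [rho_open], [rho_closed]). An isomorphism from [G] to
    [H] carries [N G] to [N H] by invariance, hence cosets to cosets; the
    permutation of the indices that it induces conjugates [hat G] to [hat H]
    ([iso_conj]). Conversely, as [G] and [hat G] are isomorphic, a permutation
    that conjugates [hat G] to [hat H] yields an isomorphism from [G] to [H]
    ([conj_iso]).

    The enumeration of the cosets has to be Borel in [G]. The relation between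
    [G] and the cosets is Borel, because a left coset [C] of [U] determines [U]
    as the quotient set [C^-1 C] ([coset_relP], [measurable_coset_rel]), and its
    sections are countable. The Lusin-Novikov theorem ([lusin_novikov]) covers
    such a relation by the graphs of countably many Borel functions, and
    counting the values that have not occurred before gives an injective
    enumeration ([effros_enumeration]). To apply it, closed sets of permutations
    are coded by the basic open sets that they meet, which makes their space a
    measurable retract of Baire space ([codeK], [measurable_code],
    [measurable_decode]). All further functions are Borel because they are
    described by countable quantifiers over the basic open sets that meet [G],
    [H], the cosets and the graph of the isomorphism ([hits_hat], [sendsP],
    [transportsP]).

    The Lusin-Novikov theorem is proved by a derivative argument that is closed
    off after two steps ([thick_cover]): there is a countable family of Borel
    functions such that no piece of what their graphs leave uncovered, not even
    over the common points of finitely many pieces, is the graph of a single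
    function. If a point of the relation is left over, every finite family of
    pieces over a common point can be split further, and this builds a perfect
    set in a single section ([alive_perfect]). The removal of a piece uses
    Lusin's separation of disjoint analytic sets ([analytic_separation]).

    Finally, a closed group of permutations is determined by its orbits on
    finite tuples, so the structure with these orbits as relations classifies
    closed groups up to conjugacy ([orbital_iso]). *)

(** * Baire space *)

(** The product topology is a supremum of initial topologies, so convergence is
    coordinatewise for any index set and any factors. In this form it also
    serves for products of products. *)
Lemma prod_topology_cvg (I : Type) (K : I -> topologicalType)
    (F : set_system (prod_topology K)) (f : prod_topology K) :
  Filter F -> (forall i, (fun g : prod_topology K => g i) @ F --> f i) ->
  F --> f.
Proof.
move=> FF Ff; apply/cvg_sup => i A [_ [[B oB <-] Bf sBA]].
apply: (filterS sBA); apply: (Ff i B).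
exact: open_nbhs_nbhs.
Qed.

Definition Baire := {ptws nat -> nat}.
HB.instance Definition _ := Topological.on Baire.
HB.instance Definition _ := isPointed.Build Baire (fun=> 0%N).

Definition agree (n : nat) (x y : nat -> nat) :=
  forall i, (i < n)%N -> y i = x i.

Lemma agreeW m n x y : (m <= n)%N -> agree n x y -> agree m x y.
Proof. by move=> mn xy i im; apply: xy; exact: leq_trans mn. Qed.

Lemma nbhs_coord (x : Baire) i : nbhs x [set y : Baire | y i = x i].
Proof.
have := @proj_continuous nat (fun=> nat) i x [set x i].
by apply; exact: discrete_set1.
Qed.

Lemma nbhs_baireP (x : Baire) (A : set Baire) :
  nbhs x A <-> exists n, forall y, agree n x y -> A y.
Proof.
split=> [xA|[n nA]].
  pose F := [set A : set Baire | exists n, forall y, agree n x y -> A y].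
  have FF : Filter F.
    split; first by exists 0%N.
    - move=> P Q [m mP] [n nQ]; exists (maxn m n) => y xy; split.
        by apply: mP; apply: agreeW xy; rewrite leq_maxl.
      by apply: nQ; apply: agreeW xy; rewrite leq_maxr.
    - by move=> P Q PQ [n nP]; exists n => y /nP/PQ.
  apply: (prod_topology_cvg (F := F) (f := x)) xA => i B xB.
  exists i.+1 => y /(_ i (ltnSn _)) yx; rewrite /= yx.
  exact: nbhs_singleton xB.
suff xn : nbhs x [set y | agree n x y] by apply: filterS xn.
elim: n {nA} => [|n IHn]; first by apply: filterS filterT.
apply: filterS2 IHn (nbhs_coord x n) => y xy yn i; rewrite ltnS leq_eqVlt.
by move=> /orP[/eqP->//|]; exact: xy.
Qed.

Lemma baire_continuousP (f : Baire -> Baire) :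
  continuous f <-> forall x i, exists n, forall y, agree n x y -> f y i = f x i.
Proof.
split=> [cf x i|cf x A /nbhs_baireP[n nA]].
  by have /nbhs_baireP := cf x _ (nbhs_coord (f x) i).
suff : nbhs x [set y | agree n (f x) (f y)] by apply: filterS => y /nA.
elim: n {nA} => [|n IHn]; first by apply: filterS filterT.
have /nbhs_baireP xn := cf x n.
apply: filterS2 IHn xn => y xy yn i; rewrite ltnS leq_eqVlt.
by move=> /orP[/eqP->//|]; exact: xy.
Qed.

Lemma baire_closedP (C : set Baire) :
  closed C <-> forall x, (forall n, exists2 y, agree n x y & C y) -> C x.
Proof.
split=> [cC x xC|CC x xC].
  apply: cC => B /nbhs_baireP[n nB]; have [y xy Cy] := xC n.
  by exists y; split => //; exact: nB.
apply: CC => n; have [|y [Cy xy]] := xC [set y | agree n x y].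
  by apply/nbhs_baireP; exists n.
by exists y.
Qed.

Definition cyl (s : seq nat) : set Baire :=
  [set x | forall i, (i < size s)%N -> x i = nth 0%N s i].

(** * Measurability of predicates *)

(** A set defined from measurable sets with connectives and countable
    quantifiers is proved measurable by following its definition. *)
Section measurable_predicates.
Context d (T : measurableType d).
Implicit Types P Q : T -> Prop.

Lemma measurable_cstP (p : Prop) : measurable [set _ : T | p].
Proof.
have [h|h] := pselect p.
  by rewrite (_ : [set _ | _] = setT); [exact: measurableT|apply/seteqP; split].
by rewrite (_ : [set _ | _] = set0); [exact: measurable0|apply/seteqP; split].
Qed.

Lemma measurable_notP P : measurable [set x | P x] ->
  measurable [set x | ~ P x].
Proof. exact: measurableC. Qed.

Lemma measurable_andP P Q : measurable [set x | P x] ->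
  measurable [set x | Q x] -> measurable [set x | P x /\ Q x].
Proof. exact: measurableI. Qed.

Lemma measurable_orP P Q : measurable [set x | P x] ->
  measurable [set x | Q x] -> measurable [set x | P x \/ Q x].
Proof. exact: measurableU. Qed.

Lemma measurable_exP (I : countType) (P : I -> T -> Prop) :
  (forall i, measurable [set x | P i x]) ->
  measurable [set x | exists i, P i x].
Proof.
move=> mP; rewrite (_ : [set x | _] = \bigcup_i [set x | P i x]).
  by apply: countable_bigcupT_measurable => //; exact: countableP.
by apply/seteqP; split=> x [i]; [exists i|exists i].
Qed.

Lemma measurable_allP (I : countType) (P : I -> T -> Prop) :
  (forall i, measurable [set x | P i x]) ->
  measurable [set x | forall i, P i x].
Proof.
move=> mP; rewrite (_ : [set x | _] = ~` [set x | exists i, ~ P i x]).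
  by apply/measurableC/measurable_exP => i; exact: measurable_notP.
by apply/seteqP; split=> x /=; [move=> Px [i]; apply|move/forallNP=> Px i;
  exact: contrapT].
Qed.

Lemma measurable_impP P Q : measurable [set x | P x] ->
  measurable [set x | Q x] -> measurable [set x | P x -> Q x].
Proof.
move=> mP mQ; rewrite (_ : [set x | _] = [set x | ~ P x \/ Q x]).
  exact/measurable_orP/mQ/measurable_notP.
apply/seteqP; split=> x /= => [PQ|[nP /nP//|Qx _//]].
  by have [/PQ|] := pselect (P x); [right|left].
Qed.

Lemma measurable_iffP P Q : measurable [set x | P x] ->
  measurable [set x | Q x] -> measurable [set x | P x <-> Q x].
Proof. by move=> mP mQ; apply: measurable_andP; exact: measurable_impP. Qed.

End measurable_predicates.

(** * Cylinders and the Borel structure of Baire space *)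

Lemma closed_cyl s : closed (cyl s).
Proof.
apply/baire_closedP => x xs i si.
by have [y /(_ i si) <- /(_ i si)] := xs (size s).
Qed.

Lemma open_cyl s : open (cyl s).
Proof.
rewrite openE => x xs; apply/nbhs_baireP; exists (size s) => y xy i si.
by rewrite xy// xs.
Qed.

Lemma cyl_mkseq (x : Baire) n y : cyl (mkseq x n) y <-> agree n x y.
Proof.
by split=> xy i ni; [have := xy i; rewrite size_mkseq nth_mkseq//; apply|
  rewrite size_mkseq in ni; rewrite nth_mkseq// xy].
Qed.

Lemma open_baire_bigcup (O : set Baire) : open O ->
  O = \bigcup_(s in [set s | cyl s `<=` O]) cyl s.
Proof.
move=> oO; apply/seteqP; split=> [x Ox|x [s] /= sO /sO//].
have /nbhs_baireP[n nO] : nbhs x O by exact: open_nbhs_nbhs.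
by exists (mkseq x n); [move=> y /cyl_mkseq /nO|apply/cyl_mkseq].
Qed.

Lemma measurable_coord i k : measurable ([set x | x i = k] : set (Borel Baire)).
Proof.
suff oU : open ([set x | x i = k] : set Baire) by exact: sub_sigma_algebra.
by rewrite openE => x /= <-; exact: nbhs_coord.
Qed.

Lemma measurable_baireP d (X : measurableType d) (f : X -> Borel Baire) :
  (forall i k, measurable [set x | f x i = k]) -> measurable_fun setT f.
Proof.
move=> mf.
refine (@measurability _ _ X (Borel Baire) setT f (@open Baire) erefl _).
move=> _ [U oU <-]; rewrite setTI (open_baire_bigcup oU).
rewrite preimage_bigcup bigcup_mkcond.
apply: countable_bigcupT_measurable => [|s]; first exact: countableP.
case: ifP => // _.
by apply: measurable_allP => i; apply: measurable_impP => //;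
  exact: measurable_cstP.
Qed.

Lemma measurable_baire_coord d (X : measurableType d)
    (f : X -> Borel Baire) i k :
  measurable_fun setT f -> measurable [set x | f x i = k].
Proof.
by move=> /(_ measurableT _ (measurable_coord i k)); rewrite setTI.
Qed.

Lemma continuous_baire_measurable (f : Baire -> Baire) :
  continuous f -> measurable_fun setT (f : Borel Baire -> Borel Baire).
Proof.
move=> cf; apply: measurable_baireP => i k.
suff oU : open ([set x | f x i = k] : set Baire) by exact: sub_sigma_algebra.
rewrite openE => x /= <-.
have /baire_continuousP/(_ x i)[n fn] := cf.
by apply/nbhs_baireP; exists n.
Qed.

Definition slice (n : nat) (x : Baire) : Baire := fun m => x (pickle (n, m)).

(** Inverse of the family of all slices: Baire space is homeomorphic to its own
    countable power. *)
Definition merge (v : nat -> Baire) : Baire :=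
  fun i => if unpickle i is Some (n, m) then v n m else 0%N.

Lemma slice_merge n v : slice n (merge v) = v n.
Proof. by apply/funext => m; rewrite /slice /merge pickleK. Qed.

Lemma slice_continuous n : continuous (slice n).
Proof.
by apply/baire_continuousP => x i; exists (pickle (n, i)).+1 => y xy; exact: xy.
Qed.

Lemma closed_eqfun (f g : Baire -> Baire) : continuous f -> continuous g ->
  closed [set x | f x = g x].
Proof.
move=> /baire_continuousP cf /baire_continuousP cg.
apply/baire_closedP => x xfg /=; apply/funext => i.
have [[m fm] [n gn]] := (cf x i, cg x i).
have [y xy /= fgy] := xfg (maxn m n).
have xym : agree m x y by apply: agreeW xy; rewrite leq_maxl.
have xyn : agree n x y by apply: agreeW xy; rewrite leq_maxr.
by rewrite -(fm _ xym) fgy (gn _ xyn).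
Qed.

Lemma closed_preim (f : Baire -> Baire) C : continuous f -> closed C ->
  closed (f @^-1` C).
Proof. by move=> /continuous_closedP; apply. Qed.

Lemma comp_continuous (f g : Baire -> Baire) : continuous f -> continuous g ->
  continuous (f \o g).
Proof. by move=> cf cg x; apply: continuous_comp; [exact: cg|exact: cf]. Qed.

(** * Analytic sets *)

(** Images of closed sets, rather than of the whole of Baire space: the empty
    set is not an exception, and families of witnesses subject to equations
    form again a closed set. *)
Definition analytic (A : set Baire) := exists C f,
  [/\ closed C, continuous (f : Baire -> Baire) & A = f @` C].

Lemma analytic_closed C : closed C -> analytic C.
Proof.
by move=> cC; exists C, id; split => //; [move=> x;
  exact: cvg_id|rewrite image_id].
Qed.

Lemma analytic_image f A : continuous (f : Baire -> Baire) -> analytic A ->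
  analytic (f @` A).
Proof.
move=> cf [C [g [cC cg ->]]]; exists C, (f \o g); split => //.
  exact: comp_continuous.
by rewrite image_comp.
Qed.

(** A point of the intersection is given by a sequence of witnesses, one in
    each of the closed sets, which all have the same image. *)
Lemma analytic_bigcap (A : nat -> set Baire) :
  (forall n, analytic (A n)) -> analytic (\bigcap_n A n).
Proof.
move=> /choice[C /choice[f Cf]].
exists (\bigcap_n (slice n @^-1` C n `&`
        [set w | f n (slice n w) = f 0%N (slice 0 w)])), (f 0%N \o slice 0).
split.
- apply: closed_bigI => n _; have [cC cf _] := Cf n.
  apply: closedI; first exact: closed_preim (@slice_continuous n) cC.
  apply: (@closed_eqfun (f n \o slice n) (f 0%N \o slice 0)).
    exact: comp_continuous (@slice_continuous n).
  by apply: comp_continuous (@slice_continuous 0); have [] := Cf 0%N.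
- by apply: comp_continuous (@slice_continuous 0); have [] := Cf 0%N.
- apply/seteqP; split=> [x Ax|_ [w wC <-] n _].
    have /choice[v v_] : forall n, exists z, C n z /\ f n z = x.
      move=> n; have := Ax n I; have [_ _ ->] := Cf n.
      by move=> -[z Cz zx]; exists z.
    exists (merge v) => [n _ /=|/=]; rewrite !slice_merge.
      by have [Cv ->] := v_ n; have [_ ->] := v_ 0%N.
    by have [] := v_ 0%N.
  have [Cw /= <-] := wC n I; have [_ _ ->] := Cf n.
  by exists (slice n w).
Qed.

Lemma analyticI A B : analytic A -> analytic B -> analytic (A `&` B).
Proof.
move=> aA aB; rewrite -bigcap2E; apply: analytic_bigcap => -[|[|n]] //=.
by apply: analytic_closed; exact: closedT.
Qed.

(** One coordinate of the witness says which of the sets is meant. It is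
    locally constant, so definitions by cases on it remain continuous. *)
Lemma analytic_bigcup (A : nat -> set Baire) :
  (forall n, analytic (A n)) -> analytic (\bigcup_n A n).
Proof.
move=> /choice[C /choice[f Cf]].
exists [set w | C (slice 0 w 0%N) (slice 1 w)],
  (fun w => f (slice 0 w 0%N) (slice 1 w)).
have tag w : exists n, forall y, agree n w y -> slice 0 y 0%N = slice 0 w 0%N.
  by have /baire_continuousP := @slice_continuous 0%N; exact.
split.
- apply/baire_closedP => w wC /=.
  have [n wn] := tag w; have [cC _ _] := Cf (slice 0 w 0%N).
  move: (closed_preim (@slice_continuous 1) cC) => /baire_closedP; apply => m.
  have [y wy Cy] := wC (maxn m n); exists y.
    by apply: agreeW wy; rewrite leq_maxl.
  by rewrite /= -(wn y)//; apply: agreeW wy; rewrite leq_maxr.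
- apply/baire_continuousP => w i; have [n wn] := tag w.
  have [_ cf _] := Cf (slice 0 w 0%N).
  have /baire_continuousP/(_ w i)[m fm] :=
    comp_continuous cf (@slice_continuous 1).
  exists (maxn m n) => y wy; rewrite wn; last first.
    by apply: agreeW wy; rewrite leq_maxr.
  by apply: fm; apply: agreeW wy; rewrite leq_maxl.
- apply/seteqP; split=> [x [n _]|_ [w wC <-]].
    have [_ _ ->] := Cf n => -[z Cz <-].
    by exists (merge (fun i => if i is 0 then fun=> n else z));
      rewrite /= !slice_merge.
  exists (slice 0 w 0%N) => //; have [_ _ ->] := Cf (slice 0 w 0%N).
  by exists (slice 1 w).
Qed.

Lemma analytic_bigcup_countable (I : countType) (A : I -> set Baire) :
  (forall i, analytic (A i)) -> analytic (\bigcup_i A i).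
Proof.
move=> aA.
rewrite (_ : \bigcup_i _ =
    \bigcup_n if unpickle n is Some i then A i else set0).
  apply: analytic_bigcup => n; case: unpickle => [//|].
  by apply: analytic_closed; exact: closed0.
apply/seteqP; split=> [x [i _ Aix]|x [n _]].
  by exists (pickle i) => //; rewrite pickleK.
by case: unpickle => // i Aix; exists i.
Qed.

(** The sets that are analytic together with their complement form a
    sigma-algebra that contains the open sets. *)
Lemma measurable_analytic (B : set (Borel Baire)) : measurable B -> analytic B.
Proof.
pose D := [set A : set Baire | analytic A /\ analytic (~` A)].
suff sD : <<s @open Baire >> `<=` D by move=> /sD[].
apply: smallest_sub; first split.
- by split; apply: analytic_closed; [exact: closed0|rewrite setC0;
    exact: closedT].
- by move=> A [aA aA']; rewrite setTD; split; rewrite ?setCK.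
- move=> A DA; split; first by apply: analytic_bigcup => n; have [] := DA n.
  by rewrite setC_bigcup; apply: analytic_bigcap => n; have [] := DA n.
move=> O oO; split; last exact/analytic_closed/open_closedC.
rewrite (open_baire_bigcup oO) bigcup_mkcond.
apply: analytic_bigcup_countable => s; case: ifP => _.
  exact/analytic_closed/closed_cyl.
by apply: analytic_closed; exact: closed0.
Qed.

Lemma cyl_rcons s (x : Baire) : cyl s x -> cyl (rcons s (x (size s))) x.
Proof.
move=> sx i; rewrite size_rcons ltnS nth_rcons leq_eqVlt.
by case: ltngtP => [si _|//|-> _]; [exact: sx|].
Qed.

Lemma choice2 (I J T : Type) (P : I -> J -> T -> Prop) :
  (forall i j, exists t, P i j t) -> exists f, forall i j, P i j (f i j).
Proof.
move=> H; have [f fP] := choice (fun ij : I * J => H ij.1 ij.2).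
by exists (fun i j => f (i, j)) => i j; exact: fP (i, j).
Qed.

(** Lusin's separation theorem. If two images cannot be separated by a Borel
    set, then neither can the images of some pair among the countably many
    smaller pieces of the two closed sets. Following such pairs leads to a
    point in each of the closed sets. Their images differ in some coordinate,
    since the images of the closed sets are disjoint; by continuity that
    coordinate separates the images of small pieces around the two points. *)
Theorem analytic_separation (A B : set Baire) :
  analytic A -> analytic B -> A `&` B = set0 ->
  exists S : set (Borel Baire), [/\ measurable S, A `<=` S & S `&` B = set0].
Proof.
move=> [C [f [cC cf ->]]] [D [g [cD cg ->]]] fg0.
pose sep s t := exists S : set (Borel Baire),
  [/\ measurable S, f @` (C `&` cyl s) `<=` S &
      S `&` g @` (D `&` cyl t) = set0].
have sepS s t : (forall i j, sep (rcons s i) (rcons t j)) -> sep s t.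
  move=> /choice2[S SP].
  exists (\bigcup_i \bigcap_j S i j); split.
  - apply: bigcupT_measurable => i; apply: bigcapT_measurable => j.
    by have [] := SP i j.
  - move=> _ [x [Cx sx] <-]; exists (x (size s)) => // j _.
    have [_ + _] := SP (x (size s)) j; apply; exists x => //; split=> //.
    exact: cyl_rcons.
  - rewrite -subset0 => z [[i _ Si] [y [Dy ty] yz]].
    have [_ _ S0] := SP i (y (size t)).
    suff : (S i (y (size t)) `&` g @` (D `&` cyl (rcons t (y (size t))))) z.
      by rewrite S0.
    split; first exact: Si.
    by exists y => //; split=> //; exact: cyl_rcons.
have [[S [mS AS SB]]|nsep] := pselect (sep [::] [::]).
  have cyl0 (E : set Baire) : E `&` cyl [::] = E.
    by apply/seteqP; split=> [x []|x Ex].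
  by exists S; split=> //; [rewrite -[C]cyl0|rewrite -[D]cyl0].
have /choice[nx nxP] (p : seq nat * seq nat) : exists ij : nat * nat,
    ~ sep p.1 p.2 -> ~ sep (rcons p.1 ij.1) (rcons p.2 ij.2).
  have [ps|nps] := pselect (sep p.1 p.2); first by exists (0, 0)%N.
  apply: contrapT => /forallNP nij; apply: nps; apply: sepS => i j.
  by apply: contrapT => nsep_ij; apply: (nij (i, j)) => _.
pose st n :=
  iter n (fun p => (rcons p.1 (nx p).1, rcons p.2 (nx p).2)) ([::], [::]).
pose x : Baire := fun n => (nx (st n)).1.
pose y : Baire := fun n => (nx (st n)).2.
have stE n : st n = (mkseq x n, mkseq y n).
  by elim: n => // n IHn; rewrite !mkseqS /x /y IHn /st iterS -/(st n) IHn.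
have nsepn n : ~ sep (mkseq x n) (mkseq y n).
  elim: n => // n IHn; have := nxP (st n); rewrite !mkseqS -[x n]/(nx (st n)).1.
  by rewrite -[y n]/(nx (st n)).2 stE /=; apply.
have Cx : C x.
  apply: (baire_closedP C).1 => // n; apply: contrapT => Cn; apply: (nsepn n).
  exists set0; split; [exact: measurable0| |by rewrite set0I].
  by move=> _ [z [Cz /cyl_mkseq xz] <-]; apply: Cn; exists z.
have Dy : D y.
  apply: (baire_closedP D).1 => // n; apply: contrapT => Dn; apply: (nsepn n).
  exists setT; split=> //.
  rewrite setTI -subset0 => _ [z [Dz /cyl_mkseq yz] <-].
  by apply: Dn; exists z.
have [m fgm] : exists m, f x m <> g y m.
  apply/existsNP => fgxy; suff : (f @` C `&` g @` D) (f x) by rewrite fg0.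
  by split; [exists x|exists y => //; apply/funext].
have /baire_continuousP/(_ x m)[n fn] := cf.
have /baire_continuousP/(_ y m)[n' gn] := cg.
exfalso; apply: (nsepn (maxn n n')).
exists [set z | z m = f x m]; split; first exact: measurable_coord.
  move=> _ [z [_ /cyl_mkseq xz] <-] /=; apply: fn.
  by apply: agreeW xz; rewrite leq_maxl.
rewrite -subset0 => u [/= um [z [_ /cyl_mkseq yz] zu]]; apply: fgm.
by rewrite -um -zu; apply: gn; apply: agreeW yz; rewrite leq_maxr.
Qed.

(** The least solution is a measurable function of the parameter. *)
Lemma measurable_nat_choice d (X : measurableType d) (P : nat -> X -> Prop) :
  (forall k, measurable [set x | P k x]) ->
  exists h : X -> nat, (forall k, measurable [set x | h x = k]) /\
    forall x, (exists k, P k x) -> P (h x) x.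
Proof.
move=> mP.
have /choice[h hP] x : exists n, (P n x /\ forall j, (j < n)%N -> ~ P j x) \/
    (n = 0%N /\ forall j, ~ P j x).
  have [[k Pk]|/forallNP nP] := pselect (exists k, P k x); last first.
    by exists 0%N; right.
  have ek : exists k, `[< P k x >] by exists k; exact/asboolP.
  exists (ex_minn ek); left; case: ex_minnP => n /asboolP Pn nmin; split=> // j.
  by rewrite ltnNge => + /asboolP/nmin nj; rewrite nj.
exists h; split=> [k|x [k Pk]]; last by have [[]//|[_ /(_ k)]] := hP x.
rewrite (_ : [set x | _] = [set x |
   (P k x /\ forall j, (j < k)%N -> ~ P j x) \/
   (k = 0%N /\ forall j, ~ P j x)]).
  apply: measurable_orP; apply: measurable_andP => //.
  - apply: measurable_allP => j; apply: measurable_impP.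
      exact: measurable_cstP.
    exact: measurable_notP.
  - exact: measurable_cstP.
  - by apply: measurable_allP => j; exact: measurable_notP.
apply/seteqP; split=> [x /= <-//|x /= [[Pk kmin]|[-> nP]]].
  have [[Ph hmin]|[_ /(_ k)//]] := hP x.
  by case: (ltngtP (h x) k) => // [/kmin//|/hmin].
by have [[/nP]|[]] := hP x.
Qed.

Lemma measurable_eq_baire d (X : measurableType d) (f g : X -> Borel Baire) :
  measurable_fun setT f -> measurable_fun setT g ->
  measurable [set x | f x = g x].
Proof.
move=> mf mg; rewrite (_ : [set x | _] =
    [set x | forall i k, f x i = k -> g x i = k]).
  apply: measurable_allP => i; apply: measurable_allP => k.
  by apply: measurable_impP; exact: measurable_baire_coord.
apply/seteqP; split=> [x /= -> //|x fg /=].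
by apply/funext => i; exact/esym/fg.
Qed.

(** * The Lusin-Novikov theorem *)

(** The relation consists of the pairs [(p w, q w)] for [w] in [C]; a piece of
    it is given by a finite sequence [s], through the cylinder of [s]. Finite
    lists of pieces are considered, not only single ones, because all branches
    of the perfect set built below have to stay over one and the same point. A
    list [L] is thin at [s] if the piece [s] needs only one more function in
    order to be covered over the common points of the shadows of the pieces in
    [L]. *)
Section lusin_novikov.
Variables (C : set Baire) (p q : Baire -> Baire).
Hypotheses (cC : closed C) (cp : continuous p) (cq : continuous q).

Implicit Types (H : nat -> Borel Baire -> Borel Baire) (s t : seq nat)
  (L : seq (seq nat)).

Definition uncovered H : set Baire :=
  C `&` [set w | forall n, H n (p w) <> q w].

Definition shadow H s : set Baire := p @` (uncovered H `&` cyl s).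

Definition alive H L := exists x, forall t, t \in L -> shadow H t x.

Definition thin H L s := forall w w',
  (uncovered H `&` cyl s) w -> (uncovered H `&` cyl s) w' -> p w = p w' ->
  (forall t, t \in L -> shadow H t (p w)) -> q w = q w'.

Lemma measurable_uncovered H : (forall n, measurable_fun setT (H n)) ->
  measurable ([set w | forall n, H n (p w) <> q w] : set (Borel Baire)).
Proof.
move=> mH; apply: measurable_allP => n.
apply/measurable_notP/measurable_eq_baire.
  exact: measurableT_comp (mH n) (continuous_baire_measurable cp).
exact: continuous_baire_measurable.
Qed.

Lemma analytic_shadow H (B : set (Borel Baire)) s :
  (forall n, measurable_fun setT (H n)) -> measurable B ->
  analytic (p @` (uncovered H `&` cyl s `&` B)).
Proof.
move=> mH mB; apply: analytic_image => //.
apply: analyticI; last exact: measurable_analytic.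
apply: analyticI; last exact/analytic_closed/closed_cyl.
apply: analyticI; first exact: analytic_closed.
by apply: measurable_analytic; exact: measurable_uncovered.
Qed.

(** A thin piece is a function with an analytic graph over an analytic set. For
    each coordinate [m] and value [k], the points over which the [m]-th
    coordinate is [k] and those over which it is not form disjoint analytic
    sets. Borel sets that separate them define a Borel function that extends
    the given one. *)
Lemma thin_covered H L s : (forall n, measurable_fun setT (H n)) ->
  thin H L s ->
  exists h : Borel Baire -> Borel Baire, measurable_fun setT h /\
    forall w, (uncovered H `&` cyl s) w ->
      (forall t, t \in L -> shadow H t (p w)) -> h (p w) = q w.
Proof.
move=> mH thinH.
pose base := [set x | forall t, t \in L -> shadow H t x].
have abase : analytic base.
  rewrite /base; elim: (L) => [|t L' IH].
    by rewrite (_ : [set x | _] = setT);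
      [exact/analytic_closed/closedT|apply/seteqP; split].
  rewrite (_ : [set x | _] =
      shadow H t `&` [set x | forall t, t \in L' -> shadow H t x]).
    apply: analyticI => //; rewrite /shadow -[_ `&` _]setIT.
    by apply: analytic_shadow => //; exact: measurableT.
  apply/seteqP; split=> [x /= Lx|x [tx /= Lx] u].
    split; first by apply: Lx; rewrite mem_head.
    by move=> u uL; apply: Lx; rewrite inE uL orbT.
  by rewrite inE => /orP[/eqP->//|]; exact: Lx.
pose hit (P : nat -> Prop) m :=
  base `&` p @` (uncovered H `&` cyl s `&` [set w | P (q w m)]).
have ahit P m : analytic (hit P m).
  apply: analyticI => //; apply: analytic_shadow => //.
  rewrite (_ : [set w | _] = [set w | exists k, P k /\ q w m = k]).
    apply: measurable_exP => k; apply: measurable_andP.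
      exact: measurable_cstP.
    by apply: measurable_baire_coord; exact: continuous_baire_measurable.
  apply/seteqP; split=> [w ?|w [k [Pk wk]]]; first by exists (q w m).
  by rewrite /= wk.
have /choice2[S SP] m k : exists S : set (Borel Baire), [/\ measurable S,
    hit (fun j => j = k) m `<=` S & S `&` hit (fun j => j <> k) m = set0].
  apply: analytic_separation => //; rewrite -subset0 => x.
  move=> [[bx [w [Uw wk] wx]] [_ [w' [Uw' w'k] w'x]]]; apply: w'k => /=.
  by rewrite -(thinH w w')// wx// w'x.
have /choice[h hP] m := @measurable_nat_choice _ _ (fun k => S m k)
  (fun k => let: And3 mS _ _ := SP m k in mS).
exists (fun x m => h m x); split.
  by apply: measurable_baireP => m k; have [] := hP m.
move=> w Uw bw; apply/funext => m.
have [_ hS] := hP m; have {}hS : S m (h m (p w)) (p w).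
  apply: hS; exists (q w m); have [_ + _] := SP m (q w m); apply.
  by split=> //; exists w.
apply: contrapT => hq; have [_ _ S0] := SP m (h m (p w)).
suff : (S m (h m (p w)) `&` hit (fun j => j <> h m (p w)) m) (p w).
  by rewrite S0.
by split=> //; split=> //; exists w => //; split=> // /esym.
Qed.

Lemma uncovered_sub H H' :
  (forall n x y, (forall n, H' n x <> y) -> H n x <> y) ->
  uncovered H' `<=` uncovered H.
Proof. by move=> HH' w [Cw H'w]; split => // n; exact: HH'. Qed.

Lemma shadow_sub H H' s : uncovered H' `<=` uncovered H ->
  shadow H' s `<=` shadow H s.
Proof. by move=> HH'; apply: image_subset => w [/HH']. Qed.

Lemma thin_sub H H' L s : uncovered H' `<=` uncovered H ->
  thin H L s -> thin H' L s.
Proof.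
move=> HH' Hthin w w' [/HH' Uw sw] [/HH' Uw' sw'] pw Lw.
by apply: Hthin => // t /Lw; exact: shadow_sub.
Qed.

Definition gather (I : countType)
    (F : I -> nat -> Borel Baire -> Borel Baire) :=
  fun n => if unpickle n is Some (i, k) then F i k else fun=> point.

Lemma gather_sub (I : countType) F (i : I) :
  uncovered (gather F) `<=` uncovered (F i).
Proof.
apply: uncovered_sub => n x y /(_ (pickle (i, n))).
by rewrite /gather pickleK.
Qed.

Lemma measurable_gather (I : countType) F :
  (forall (i : I) n, measurable_fun setT (F i n)) ->
  forall n, measurable_fun setT (gather F n).
Proof.
move=> mF n; rewrite /gather; case: unpickle => [[i k]|]; first exact: mF.
exact: measurable_cst.
Qed.

(** As there are only countably many pairs [(L, s)], a single family [H1] makes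
    thin all the pairs that some family makes thin, and [H2] adds to [H1]
    functions that cover the pieces that are thin for [H1]. If [H2] made an
    alive pair thin, the pair would be one of those that [H1] makes thin, and
    the piece would be covered by a function in [H2]. This takes the place of a
    transfinite iteration of derivatives. *)
Lemma thick_cover : exists H, (forall n, measurable_fun setT (H n)) /\
  forall L s, s \in L -> alive H L -> ~ thin H L s.
Proof.
pose killable (a : seq (seq nat) * seq nat) := exists H,
  (forall n, measurable_fun setT (H n)) /\ thin H a.1 a.2.
have /choice[K KP] a : exists H, (forall n, measurable_fun setT (H n)) /\
    (killable a -> thin H a.1 a.2).
  have [[H [mH thinH]]|nk] := pselect (killable a); first by exists H.
  by exists (fun=> cst point); split=> // n; exact: measurable_cst.
pose H1 := gather K.
have mH1 : forall n, measurable_fun setT (H1 n).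
  by apply: measurable_gather => a; have [] := KP a.
have thinH1 a : killable a -> thin H1 a.1 a.2.
  move=> ka; apply: (@thin_sub (K a)); first exact: gather_sub.
  by have [_ ] := KP a; apply.
have /choice[h hP] (a : seq (seq nat) * seq nat) :
    exists h : Borel Baire -> Borel Baire,
    measurable_fun setT h /\
    (killable a -> forall w, (uncovered H1 `&` cyl a.2) w ->
      (forall t, t \in a.1 -> shadow H1 t (p w)) -> h (p w) = q w).
  have [ka|nk] := pselect (killable a); last first.
    by exists (cst point); split=> //; exact: measurable_cst.
  by have [h [mh hP]] := thin_covered mH1 (thinH1 _ ka); exists h.
pose H2 :=
  gather (fun b : bool => if b then H1 else gather (fun a => fun=> h a)).
have H21 : uncovered H2 `<=` uncovered H1 by exact: (@gather_sub _ _ true).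
have H2h a w : uncovered H2 w -> h a (p w) <> q w.
  move=> /(@gather_sub _ _ false)/(@gather_sub _ _ a) [_ /(_ 0%N)]; exact.
have mH2 : forall n, measurable_fun setT (H2 n).
  apply: measurable_gather => -[]//; apply: measurable_gather => a _.
  by have [] := hP a.
exists H2; split=> // L s sL [x xL] thinH2.
have [w [Uw sw] wx] := xL _ sL.
apply: (H2h (L, s) w Uw); have [_ ->//] := hP (L, s).
- by exists H2.
- by split=> //; exact: H21.
- by move=> t /= /xL; rewrite wx; exact: shadow_sub.
Qed.

Definition extends s t := (size s < size t)%N /\ cyl t `<=` cyl s.

Definition separated s t := forall w w', cyl s w -> cyl t w' -> q w <> q w'.

Lemma alive_sub H L L' : {subset L <= L'} -> alive H L' -> alive H L.
Proof. by move=> LL' [x xL]; exists x => t /LL'/xL. Qed.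

Section perfect.
Variable H : nat -> Borel Baire -> Borel Baire.
Hypothesis Hthick : forall L s, s \in L -> alive H L -> ~ thin H L s.

Lemma split_one L s : s \in L -> alive H L -> exists s0 s1,
  [/\ extends s s0, extends s s1, separated s0 s1 & alive H [:: s0, s1 & L]].
Proof.
move=> sL aL; apply: contrapT => nsplit; apply: (Hthick sL aL) => w w'.
move=> [Uw sw] [Uw' sw'] ww' Lw; apply/funext => m; apply: contrapT => qm.
apply: nsplit.
have /baire_continuousP cq' := cq.
have [[n wn] [n' wn']] := (cq' w m, cq' w' m).
(* long enough to extend s properly and to decide coordinate m of q *)
pose N := maxn (size s).+1 (maxn n n').
have extN v : cyl s v -> extends s (mkseq v N).
  move=> sv; split; first by rewrite size_mkseq leq_maxl.
  move=> u /cyl_mkseq vu i si; rewrite vu ?sv//.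
  by rewrite (leq_trans si)// (leq_trans (leqnSn _))// leq_maxl.
exists (mkseq w N), (mkseq w' N); split; [exact: extN|exact: extN| |].
- move=> v v' /cyl_mkseq wv /cyl_mkseq wv' qvv'; apply: qm.
  rewrite -(wn v) ?qvv'.
    by apply: wn'; apply: agreeW wv'; rewrite /N !leq_max leqnn !orbT.
  by apply: agreeW wv; rewrite /N !leq_max leqnn !orbT.
- exists (p w) => t; rewrite !inE => /or3P[/eqP->|/eqP->|/Lw//].
    by exists w => //; split=> //; exact/cyl_mkseq.
  by exists w' => //; split=> //; exact/cyl_mkseq.
Qed.

(** The pieces that have been split stay in the list: only more pieces have to
    be kept over a common point, and the induction never replaces an entry. *)
Lemma split_all L M : {subset L <= M} -> alive H M ->
  exists a : bool -> seq nat -> seq nat,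
    (forall s, s \in L -> (forall b, extends s (a b s)) /\
       separated (a false s) (a true s)) /\
    alive H (map (a false) L ++ map (a true) L ++ M).
Proof.
elim: L M => [|s L IH] M LM aM; first by exists (fun=> id).
have [||a [aP aA]] := IH M => //.
  by move=> t tL; apply: LM; rewrite inE tL orbT.
have [sL|sL] := boolP (s \in L).
  exists a; split=> [t|]; first by rewrite inE => /orP[/eqP->|]; exact: aP.
  apply: alive_sub aA => t; rewrite !(mem_cat, inE).
  move=> /orP[/orP[/eqP->|->//]|/orP[/orP[/eqP->|->]|->]]; rewrite ?orbT//.
    by rewrite map_f.
  by rewrite map_f ?orbT.
have [|s0 [s1 [e0 e1 s01 al]]] := split_one _ aA (s := s).
  by rewrite !mem_cat (LM s) ?mem_head ?orbT.
pose a' b t := if t == s then (if b then s1 else s0) else a b t.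
have a'L b : map (a' b) L = map (a b) L.
  apply/eq_in_map => t tL; rewrite /a'; case: eqP => // ts.
  by rewrite -ts tL in sL.
exists a'; split=> [t|].
  rewrite inE /a'; case: eqP => /= [-> _|_]; last exact: aP.
  by split=> // -[].
apply: alive_sub al => t; rewrite !map_cons !a'L /a' eqxx !(mem_cat, inE).
by do ![case/orP]=> ->; rewrite ?orbT.
Qed.

(** All the pieces of one level lie over a common point, so by continuity the
    branches have the same image under [p] in the limit. The two halves of each
    piece have disjoint images under [q], hence so do distinct branches. *)
Lemma alive_perfect : alive H [:: [::]] ->
  exists z : (nat -> bool) -> Baire,
    [/\ forall b, C (z b), forall b b', p (z b) = p (z b') &
        injective (q \o z)].
Proof.
move=> a0.
have /choice[a aP] L : exists a : bool -> seq nat -> seq nat, alive H L ->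
    (forall s, s \in L -> (forall b, extends s (a b s)) /\
       separated (a false s) (a true s)) /\
    alive H (map (a false) L ++ map (a true) L).
  have [aL|naL] := pselect (alive H L); last by exists (fun=> id).
  have [//|a [aP aA]] := @split_all L L _ aL; exists a => _; split=> //.
  by apply: alive_sub aA => t; rewrite !mem_cat => /orP[]->; rewrite ?orbT.
pose fix lv n := if n is n'.+1
  then map (a (lv n') false) (lv n') ++ map (a (lv n') true) (lv n')
  else [:: [::]].
have alv n : alive H (lv n) by elim: n => //= n /aP[].
pose br (b : nat -> bool) := fix br n :=
  if n is n'.+1 then a (lv n') (b n') (br n') else [::].
have br_lv b n : br b n \in lv n.
  elim: n => [|n IHn] /=; first by rewrite mem_seq1.
  by rewrite mem_cat; case: (b n); rewrite map_f ?orbT.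
have br_ext b n : extends (br b n) (br b n.+1).
  by have [/(_ _ (br_lv b n))[+ _] _] := aP _ (alv n); apply.
have br_size b n : (n <= size (br b n))%N.
  by elim: n => // n IHn; have [+ _] := br_ext b n; exact: leq_ltn_trans.
have nth_br b n m i : (n <= m)%N -> (i < size (br b n))%N ->
    nth 0%N (br b m) i = nth 0%N (br b n) i.
  move=> + si; elim: m => [|m IHm]; first by rewrite leqn0 => /eqP->.
  rewrite leq_eqVlt => /orP[/eqP->//|]; rewrite ltnS => nm.
  rewrite -(IHm nm); have [_ sub] := br_ext b m.
  apply: (sub (fun i => nth 0%N (br b m.+1) i)) => //.
  elim: m nm {IHm sub} => [|m IHm]; first by rewrite leqn0 => /eqP<-.
  rewrite leq_eqVlt => /orP[/eqP<-//|]; rewrite ltnS => /IHm im.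
  by have [sm _] := br_ext b m; exact: ltn_trans im sm.
pose z b : Baire := fun i => nth 0%N (br b i.+1) i.
have z_br b n : cyl (br b n) (z b).
  move=> i si; rewrite /z; have [ni|ni] := leqP i.+1 n.
    by rewrite (nth_br b i.+1)//; exact: br_size.
  by apply: nth_br => //; exact: ltnW.
have z_near b n w : cyl (br b n) w -> agree n (z b) w.
  move=> bw i ni; have si := leq_trans ni (br_size b n).
  by rewrite bw// (z_br b n).
exists z; split.
- move=> b; apply: (baire_closedP C).1 => // n.
  have [x /(_ _ (br_lv b n))[w [[Cw _] bw] _]] := alv n.
  by exists w => //; exact: z_near.
- move=> b b'; apply/funext => m.
  have /baire_continuousP cp' := cp.
  have [[n zn] [n' zn']] := (cp' (z b) m, cp' (z b') m).
  have [x xP] := alv (maxn n n').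
  have [w [_ bw] wx] := xP _ (br_lv b _).
  have [w' [_ bw'] w'x] := xP _ (br_lv b' _).
  rewrite -(zn w) ?wx; last first.
    by apply: agreeW (z_near _ _ _ bw); rewrite leq_maxl.
  rewrite -w'x; apply: zn'.
  by apply: agreeW (z_near _ _ _ bw'); rewrite leq_maxr.
- move=> b b' /= qbb'; apply: contrapT => bb'.
  have ex : exists i, b i != b' i.
    apply: contrapT => /forallNP bE; apply: bb'; apply/funext => i.
    by apply/eqP; apply: contrapT => /negP; exact: bE.
  pose i := ex_minn ex.
  have [bi bmin] : b i != b' i /\ forall j, (j < i)%N -> b j = b' j.
    rewrite /i; case: ex_minnP => k bk kmin; split=> // j.
    by apply: contraTeq => /kmin; rewrite -leqNgt.
  have brE : br b i = br b' i.
    elim: (i) bmin => //= k IHk bmin; rewrite bmin// IHk// => j jk.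
    by apply: bmin; exact: ltnW.
  have [/(_ _ (br_lv b i))[_ sep] _] := aP _ (alv i).
  have := (z_br b i.+1, z_br b' i.+1); rewrite /= -brE.
  case: (b i) (b' i) bi => -[]// _ [zb zb'].
    by apply: (sep _ _ zb' zb); rewrite qbb'.
  exact: (sep _ _ zb zb').
Qed.

End perfect.

Lemma cantor_uncountable (T : Type) (A : set T) (z : (nat -> bool) -> T) :
  injective z -> (forall b, A (z b)) -> ~ countable A.
Proof.
move=> zinj zA /countable_injP[f finj].
pose g b := f (z b); have ginj : injective g.
  by move=> b b' /finj; rewrite !inE => /(_ (zA _) (zA _))/zinj.
(* Cantor's diagonal set: the number g b belongs to it exactly if it does not
   belong to b *)
pose D n := `[< exists b, g b = n /\ ~~ b n >].
have nD : ~ D (g D) by move=> /[dup] Dg /asboolP[b [/ginj ->]]; rewrite Dg.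
by apply: (nD); apply/asboolP; exists D; split=> //; exact/negP.
Qed.

(** A pair not covered by the family of [thick_cover] would give a perfect set
    in one of the sections. *)
Theorem lusin_novikov :
  (forall x, countable [set q w | w in C `&` p @^-1` [set x]]) ->
  exists H : nat -> Borel Baire -> Borel Baire,
    (forall n, measurable_fun setT (H n)) /\
    forall w, C w -> exists n, H n (p w) = q w.
Proof.
move=> Ccount; have [H [mH Hthick]] := thick_cover.
exists H; split=> // w Cw; apply: contrapT => /forallNP Hw.
have [|z [zC zp qz]] := @alive_perfect H Hthick.
  by exists (p w) => t; rewrite inE => /eqP->; exists w.
apply: (cantor_uncountable qz) (Ccount (p (z (fun=> true)))) => b.
by exists (z b) => //; split => //; exact: zp.
Qed.

End lusin_novikov.

(** * Basic open sets of permutations *)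

Definition basic (p : seq (nat * nat)) : set Sinfty :=
  [set g | all (fun ab => perm_fun g ab.1 == ab.2) p].

Lemma basicP p (g : Sinfty) :
  basic p g <-> forall a b, (a, b) \in p -> perm_fun g a = b.
Proof.
split=> [/allP/= pg a b /pg/eqP//|pg].
by apply/allP => -[a b] /pg /= ->.
Qed.

Lemma basic_cat p r g : basic (p ++ r) g <-> basic p g /\ basic r g.
Proof. by rewrite /basic /= all_cat; split=> [/andP|[-> ->]]. Qed.

Lemma basic_sub p r : {subset p <= r} -> basic r `<=` basic p.
Proof. by move=> pr g /basicP rg; apply/basicP => a b /pr/rg. Qed.

Lemma nbhs_SinftyP (g : Sinfty) (A : set Sinfty) :
  nbhs g A <-> exists2 p, basic p g & basic p `<=` A.
Proof.
split=> [[_ [[B oB <-] Bg sBA]]|[p pg pA]].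
  have /nbhs_baireP[n nB] : nbhs (perm_fun g : Baire) B.
    exact: open_nbhs_nbhs.
  exists [seq (i, perm_fun g i) | i <- iota 0 n].
    by apply/basicP => a b /mapP[i _ [-> ->]].
  move=> h /basicP hg; apply: sBA; apply: nB => i ni.
  by apply: hg; apply/mapP; exists i; rewrite ?mem_iota.
suff : nbhs g (basic p) by apply: filterS.
elim: p pg {pA} => [_|[a b] p IHp]; first by apply: filterS filterT.
rewrite /basic /= => /andP[/eqP ga] /IHp np.
have na : nbhs g [set h : Sinfty | perm_fun h a = perm_fun g a].
  exact: (@initial_continuous Sinfty Baire perm_fun g _ (nbhs_coord _ a)).
by apply: filterS2 na np => h /= -> ->; rewrite ga eqxx.
Qed.

Definition hits (D : set Sinfty) p := exists2 g, D g & basic p g.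

Lemma open_basic p : open (basic p).
Proof. by rewrite openE => g pg; apply/nbhs_SinftyP; exists p. Qed.

Lemma closed_SinftyP (D : set Sinfty) :
  closed D <-> forall g, (forall p, basic p g -> hits D p) -> D g.
Proof.
split=> [cD g gD|gD g cDg].
  apply: cD => B /nbhs_SinftyP[p /gD[h Dh ph] pB]; exists h.
  by split=> //; exact: pB.
apply: gD => p pg; have [|h [Dh ph]] := cDg (basic p).
  by apply/nbhs_SinftyP; exists p.
by exists h.
Qed.

Lemma open_Sinfty_bigcup (U : set Sinfty) : open U ->
  U = \bigcup_(p in [set p | basic p `<=` U]) basic p.
Proof.
move=> oU; apply/seteqP; split=> [x Ux|x [s] /= sU /sU//].
have /nbhs_SinftyP[p px pU] : nbhs x U by exact: open_nbhs_nbhs.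
by exists p.
Qed.

Lemma closed_effros (T : topologicalType) (D : Effros T) : closed (D : set T).
Proof. exact: set_mem (valP (D : closed_sets T)). Qed.

Definition mk_effros (T : topologicalType) (D : set T) (cD : closed D) :
    Effros T :=
  SigSub (mem_set (cD : [set D : set T | closed D] D)) : closed_sets T.

Lemma mk_effrosE (T : topologicalType) (D : set T) (cD : closed D) :
  mk_effros cD = D :> set T.
Proof. by []. Qed.

Lemma effros_inj (T : topologicalType) (D E : Effros T) :
  D = E :> set T -> D = E.
Proof. exact: val_inj. Qed.

Lemma effros_hitsP (D E : Effros Sinfty) :
  (forall p, hits D p <-> hits E p) -> D = E.
Proof.
move=> DE; apply: effros_inj; apply/seteqP; split=> g Dg.
  apply: (closed_SinftyP _).1 (@closed_effros _ E) _ _ => p pg.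
  by apply/DE; exists g.
apply: (closed_SinftyP _).1 (@closed_effros _ D) _ _ => p pg.
by apply/DE; exists g.
Qed.

Lemma measurable_effros_open (T : topologicalType) (U : set T) : open U ->
  measurable [set D : Effros T | (D : set T) `&` U !=set0].
Proof. by move=> oU; apply: sub_sigma_algebra; exists U. Qed.

Lemma measurable_hits p : measurable [set D : Effros Sinfty | hits D p].
Proof.
rewrite (_ : [set D | _] =
    [set D : Effros Sinfty | (D : set Sinfty) `&` basic p !=set0]).
  by apply: measurable_effros_open; exact: open_basic.
by apply/seteqP; split=> D [g]; [exists g|case=> Dg pg; exists g].
Qed.

Lemma measurable_hitsT d (X : measurableType d) (f : X -> Effros Sinfty) p :
  measurable_fun setT f -> measurable [set x | hits (f x) p].
Proof. by move=> /(_ measurableT _ (measurable_hits p)); rewrite setTI. Qed.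

Lemma measurable_effrosP d (X : measurableType d) (f : X -> Effros Sinfty) :
  (forall p, measurable [set x | hits (f x) p]) -> measurable_fun setT f.
Proof.
move=> mf; refine (@measurability _ _ X (Effros Sinfty) setT f
  (@effros_system Sinfty) erefl _).
move=> _ [_ [U oU <-] <-]; rewrite setTI.
rewrite (_ : _ @^-1` _ = [set x | exists p, basic p `<=` U /\ hits (f x) p]).
  by apply: measurable_exP => p; apply: measurable_andP => //;
    exact: measurable_cstP.
apply/seteqP; split=> x /=.
  move=> [g [fg Ug]].
  have [p pU pg] : (\bigcup_(p in [set p | basic p `<=` U]) basic p) g.
    by rewrite -open_Sinfty_bigcup.
  by exists p; split; [exact: pU|exists g].
by move=> [p [pU [g fg /pU Ug]]]; exists g.
Qed.

(** * Coding closed sets of permutations in Baire space *)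

Definition code (D : Effros Sinfty) : Borel Baire :=
  fun i => if unpickle i is Some p then nat_of_bool `[< hits D p >] else 0%N.

Lemma codeP D p : code D (pickle p) = 1%N <-> hits D p.
Proof.
rewrite /code pickleK; split=> [|Dp]; last by rewrite asboolT.
by case: asboolP.
Qed.

Lemma measurable_code : measurable_fun setT code.
Proof.
apply: measurable_baireP => i k; rewrite /code.
case: unpickle => [p|]; last exact: measurable_cstP.
rewrite (_ : [set D | _] = [set D : Effros Sinfty |
   hits D p /\ 1%N = k \/ ~ hits D p /\ 0%N = k]).
  apply: measurable_orP; apply: measurable_andP; rewrite ?measurable_cstP//.
  - exact: measurable_hits.
  - exact: measurable_cstP.
  - by apply: measurable_notP; exact: measurable_hits.
  - exact: measurable_cstP.
apply/seteqP; split=> D /=; case: asboolP => /= Dp; do ?by [left|right].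
  by move=> [[//]|[]].
by move=> [[//]|[]].
Qed.

Definition partial_perm (p : seq (nat * nat)) :=
  forall x y, x \in p -> y \in p -> (x.1 == y.1) = (x.2 == y.2).

(** The codes of closed sets, where the pairs in [p] record values of a
    permutation. The last two clauses allow one to extend [p] so that a given
    number is in the domain and in the range; they make the limit of a chain of
    recorded lists a permutation. *)
Definition admissible (c : Borel Baire) :=
  forall p : seq (nat * nat), c (pickle p) = 1%N ->
  [/\ partial_perm p,
     forall r : seq (nat * nat), {subset r <= p} -> c (pickle r) = 1%N,
     forall n, exists a, c (pickle ((n, a) :: p)) = 1%N &
     forall n, exists a, c (pickle ((a, n) :: p)) = 1%N].

Definition decode_set (c : Borel Baire) : set Sinfty :=
  [set g | admissible c /\
    forall p : seq (nat * nat), basic p g -> c (pickle p) = 1%N].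

Lemma closed_decode_set c : closed (decode_set c).
Proof.
apply: (closed_SinftyP _).2 => g gc; split; last by move=> p /gc[h [_]]; exact.
by have [] := gc [::] isT => h [].
Qed.

(** Total, with the empty set for codes that are not admissible; this makes it
    measurable on the whole of Baire space. *)
Definition decode (c : Borel Baire) := mk_effros (@closed_decode_set c).

Lemma admissible_code D : admissible (code D).
Proof.
move=> p /codeP[g Dg pg]; split.
- move=> [a b] [a' b'] /((basicP _ _).1 pg) <- /((basicP _ _).1 pg) <- /=.
  by apply/idP/idP => [/eqP->//|/eqP/(bij_inj (perm_fun_bij g))->].
- by move=> r rp; apply/codeP; exists g => //; exact: basic_sub pg.
- move=> n; exists (perm_fun g n); apply/codeP; exists g => //.
  by rewrite /basic /= eqxx.
- move=> n; exists (perm_fun g^-1%g n); apply/codeP; exists g => //.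
  rewrite /basic /= -[perm_fun g _]/(perm_fun (g * g^-1)%g n) mulgV.
  by rewrite eqxx.
Qed.

Lemma codeK : cancel code decode.
Proof.
move=> D; apply: effros_inj; apply/seteqP; split=> g.
  move=> [_ gD]; apply: (closed_SinftyP _).1 (@closed_effros _ D) _ _ => p.
  by move=> /gD/codeP.
by move=> Dg; split; [exact: admissible_code|move=> p pg; apply/codeP;
  exists g].
Qed.

(** An admissible code that records [p] also records a chain of extensions of
    [p] in which every number enters the domain and the range. The union of the
    chain is a permutation in the decoded set. *)
Lemma hits_decode c p :
  hits (decode c) p <-> admissible c /\ c (pickle p) = 1%N.
Proof.
split=> [[g [ac gc] pg]|[ac cp]]; first by split=> //; exact: gc.
have /choice[nx nxP] (rn : seq (nat * nat) * nat) : exists r' : seq (nat * nat),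
    c (pickle rn.1) = 1%N -> [/\ c (pickle r') = 1%N, {subset rn.1 <= r'},
      exists a, (rn.2, a) \in r' & exists a, (a, rn.2) \in r'].
  case: rn => r n /=.
  have [cr|ncr] := pselect (c (pickle r) = 1%N); last by exists r.
  have [_ _ /(_ n)[a ca] _] := ac _ cr.
  have [_ _ _ /(_ n)[b cb]] := ac _ ca.
  exists [:: (b, n), (n, a) & r] => _; split=> //.
  - by move=> x xr; rewrite !inE xr !orbT.
  - by exists a; rewrite !inE eqxx orbT.
  - by exists b; rewrite inE eqxx.
pose P := fix P n := if n is n'.+1 then nx (P n', n') else p.
have cP n : c (pickle (P n)) = 1%N by elim: n => //= n /(nxP (P n, n))[].
have PS m n : (m <= n)%N -> {subset P m <= P n}.
  move=> /subnK <-; elim: (n - m)%N => // k IHk x /IHk.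
  by have [_ + _ _] := nxP (P (k + m)%N, (k + m)%N) (cP _); exact.
have /choice[g gP] n : exists a, (n, a) \in P n.+1.
  by have [] := nxP (P n, n) (cP _).
have /choice[h hP] n : exists a, (a, n) \in P n.+1.
  by have [] := nxP (P n, n) (cP _).
have inP m n x y : x \in P m -> y \in P n -> (x.1 == y.1) = (x.2 == y.2).
  move=> xm yn; have [pp _ _ _] := ac _ (cP (maxn m n)).
  by apply: pp; [apply: PS xm|apply: PS yn]; rewrite ?leq_maxl ?leq_maxr.
have gbij : bijective g.
  exists h => n; apply/eqP.
    by rewrite (inP _ _ _ _ (hP (g n)) (gP n)).
  by rewrite -(inP _ _ _ _ (gP (h n)) (hP n)).
exists (mk_perm gbij); last first.
  apply/basicP => a b ab; apply/eqP; rewrite /perm_fun /=.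
  by rewrite -(inP _ 0%N _ _ (gP a) ab).
split=> // q /basicP qg; have [N qN] : exists N, {subset q <= P N}.
  elim: q qg => [|[a b] q IHq] qg; first by exists 0%N.
  have [|N qN] := IHq; first by move=> u v uq; apply: qg; rewrite inE uq orbT.
  exists (maxn N a.+1) => x; rewrite inE => /orP[/eqP->|/qN].
    have <- : g a = b by apply: qg; rewrite mem_head.
    by apply: PS (gP a); rewrite leq_maxr.
  by apply: PS; rewrite leq_maxl.
by have [_ + _ _] := ac _ (cP N); apply.
Qed.

Lemma measurable_admissible : measurable [set c | admissible c].
Proof.
have mc p : measurable [set c : Borel Baire | c (pickle p) = 1%N].
  exact: measurable_coord.
rewrite (_ : [set c | _] = [set c : Borel Baire |
  forall p : seq (nat * nat), c (pickle p) = 1%N -> partial_perm p /\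
    ((forall r : seq (nat * nat), {subset r <= p} -> c (pickle r) = 1%N) /\
     ((forall n, exists a, c (pickle ((n, a) :: p)) = 1%N) /\
     forall n, exists a, c (pickle ((a, n) :: p)) = 1%N))]).
  apply: measurable_allP => p; apply: measurable_impP => //.
  apply: measurable_andP; first exact: measurable_cstP.
  apply: measurable_andP.
    apply: measurable_allP => r; apply: measurable_impP => //.
    exact: measurable_cstP.
  by apply: measurable_andP; apply: measurable_allP => n; apply: measurable_exP.
by apply/seteqP; split=> c /= ac p /ac => [[]//|[? [? []]]].
Qed.

Lemma measurable_decode : measurable_fun setT decode.
Proof.
apply: measurable_effrosP => p.
rewrite (_ : [set c | _] = [set c | admissible c /\ c (pickle p) = 1%N]).
  apply: measurable_andP; first exact: measurable_admissible.
  exact: measurable_coord.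
by apply/seteqP; split=> c /=; rewrite hits_decode.
Qed.

(** * Borel enumeration of countable sections *)

Lemma measurable_eq_effros d (X : measurableType d) (f g : X -> Effros Sinfty) :
  measurable_fun setT f -> measurable_fun setT g ->
  measurable [set x | f x = g x].
Proof.
move=> mf mg; rewrite (_ : [set x | _] =
    [set x | forall p, hits (f x) p <-> hits (g x) p]).
  apply: measurable_allP => p.
  by apply: measurable_iffP; exact: measurable_hitsT.
by apply/seteqP; split=> [x /= -> //|x fg /=]; exact: effros_hitsP.
Qed.

(** The space of closed sets of permutations is a measurable retract of Baire
    space, so the relation can be pulled back to Baire space and the resulting
    functions pushed forward. *)
Theorem effros_lusin_novikov (R : set (Effros Sinfty * Effros Sinfty)) :
  measurable R -> (forall D, countable [set E | R (D, E)]) ->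
  exists h : nat -> Effros Sinfty -> Effros Sinfty,
    (forall n, measurable_fun setT (h n)) /\
    forall D E, R (D, E) -> exists n, h n D = E.
Proof.
move=> mR cR.
have mslice n : measurable_fun setT (slice n : Borel Baire -> Borel Baire).
  by apply: continuous_baire_measurable; exact: slice_continuous.
have mdec n : measurable_fun setT (fun w : Borel Baire => decode (slice n w)).
  exact: measurableT_comp measurable_decode (mslice n).
have mcode n :
    measurable_fun setT (fun w : Borel Baire => code (decode (slice n w))).
  exact: measurableT_comp measurable_code (mdec n).
pose A : set (Borel Baire) := [set w |
  R (decode (slice 0 w), decode (slice 1 w)) /\
  (code (decode (slice 0 w)) = slice 0 w /\
   code (decode (slice 1 w)) = slice 1 w)].
have [C [f [cC cf AE]]] : analytic A.
  apply: measurable_analytic; apply: measurable_andP; last first.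
    by apply: measurable_andP; apply: measurable_eq_baire.
  rewrite -[X in measurable X]setTI.
  exact: (measurable_fun_pair (mdec 0) (mdec 1)).
have AC w : C w -> A (f w) by move=> Cw; rewrite AE; exists w.
have [||x|H [mH HP]] := @lusin_novikov C (slice 0 \o f) (slice 1 \o f) cC.
- exact: comp_continuous (@slice_continuous 0) cf.
- exact: comp_continuous (@slice_continuous 1) cf.
- apply: (sub_countable _ (cR (decode x))).
  apply: card_le_trans (card_image_le code _); apply: subset_card_le.
  move=> _ [w [/AC[Rw [_ w1]] <-] <-] /=.
  by exists (decode (slice 1 (f w))).
exists (fun n => decode \o H n \o code); split=> [n|D E DE].
  by apply: measurableT_comp measurable_code;
    exact: measurableT_comp measurable_decode (mH n).
have : A (merge (fun n => if n is 0 then code D else code E)).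
  by rewrite /A /= !slice_merge !codeK.
rewrite AE => -[w /HP[n Hn] fw]; exists n.
by move: Hn; rewrite /= fw !slice_merge => ->; rewrite codeK.
Qed.

(** Among the values at [D] of the functions that cover the sections, keep
    those which belong to the section and have not occurred before. The index
    of the [k]-th of them is found by counting, hence measurable in [D]. *)
Theorem effros_enumeration (R : set (Effros Sinfty * Effros Sinfty)) :
  measurable R -> (forall D, countable [set E | R (D, E)]) ->
  exists c : nat -> Effros Sinfty -> Effros Sinfty,
    (forall k, measurable_fun setT (c k)) /\
    forall D, infinite_set [set E | R (D, E)] ->
      injective (c^~ D) /\ forall E, R (D, E) <-> exists k, c k D = E.
Proof.
move=> mR cR; have [h [mh hP]] := effros_lusin_novikov mR cR.
pose valid n := [set D | R (D, h n D)].
have mvalid n : measurable (valid n).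
  rewrite -[X in measurable X]setTI.
  exact: (measurable_fun_pair (@measurable_id _ _ setT) (mh n)).
(* the first index at which a given member of the section occurs *)
pose new n D := valid n D /\ forall j : 'I_n, ~ (valid j D /\ h j D = h n D).
have mnew n : measurable [set D | new n D].
  apply: measurable_andP; first exact: mvalid.
  apply: (@measurable_allP _ _ 'I_n) => j.
  by apply: measurable_notP; apply: measurable_andP (mvalid j) _;
    exact: measurable_eq_effros.
(* the number of new indices below n, so that the new indices are recovered
   injectively from their count *)
pose cnt := fix cnt n D :=
  if n is n'.+1 then (cnt n' D + `[< new n' D >])%N else 0%N.
have mcnt n k : measurable [set D | cnt n D = k].
  elim: n k => [|n IHn] k; first exact: (measurable_cstP _ (0%N = k)).
  rewrite (_ : [set D | _] = [set D |
      (new n D /\ exists j, cnt n D = j /\ j.+1 = k) \/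
      (~ new n D /\ cnt n D = k)]).
    apply: measurable_orP; apply: measurable_andP => //;
      last exact: measurable_notP.
    apply: measurable_exP => j; apply: measurable_andP => //.
    exact: measurable_cstP.
  apply/seteqP; split=> D /=; case: asboolP => nD; rewrite ?addn1 ?addn0.
  - by move=> ck; left; split=> //; exists (cnt n D).
  - by right.
  - by move=> [[_ [j [-> ->]]]|[]].
  - by move=> [[]|[]].
have cnt_le n m D : (n <= m)%N -> (cnt n D <= cnt m D)%N.
  by move=> /subnK <-; elim: (m - n)%N => // j IHj;
    rewrite (leq_trans IHj)// leq_addr.
have cnt_lt n m D : new n D -> (n < m)%N -> (cnt n D < cnt m D)%N.
  move=> nD /(cnt_le _ _ D); apply: leq_trans => /=.
  by rewrite asboolT// addn1.
have /choice[i iP] k := @measurable_nat_choice _ (Effros Sinfty)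
  (fun n D => new n D /\ cnt n D = k)
  (fun n => measurable_andP (mnew n) (mcnt n k)).
exists (fun k D => h (i k D) D); split=> [k|D Dinf].
  apply: measurable_effrosP => p.
  rewrite (_ : [set D | _] = [set D | exists n, i k D = n /\ hits (h n D) p]).
    apply: measurable_exP => n; apply: measurable_andP;
      first by have [] := iP k.
    exact: measurable_hitsT.
  by apply/seteqP; split=> [D /= ?|D /= [n [-> ?]]//]; exists (i k D).
have newP n : valid n D -> exists2 m, new m D & h m D = h n D.
  move=> vn; have en : exists m, `[< valid m D /\ h m D = h n D >].
    by exists n; exact/asboolP.
  case: (ex_minnP en) => m /asboolP[vm hm] mmin; exists m => //;
    split=> // j [vj hj].
  have := mmin j; rewrite leqNgt ltn_ord => /(_ _)/negP; apply => //.
  by apply/asboolP; rewrite hj.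
have new_ex N : exists2 n, (N <= n)%N & new n D.
  apply: contrapT => nnew; apply: Dinf.
  apply: (@sub_finite_set _ _ ((h^~ D) @` `I_N)); last first.
    by apply: finite_image; exact: finite_II.
  move=> E /= DE; have [n hn] := hP _ _ DE.
  have [|m newm hm] := newP n; first by rewrite /valid /= hn.
  exists m => /=; last by rewrite hm.
  by rewrite ltnNge; apply/negP => Nm; apply: nnew; exists m.
have next N : exists n, new n D /\ cnt n D = cnt N D.
  have [n Nn newn] := new_ex N.
  have en : exists n, (N <= n)%N && `[< new n D >].
    by exists n; rewrite Nn; exact/asboolP.
  case: (ex_minnP en) => m /andP[Nm /asboolP newm] mmin; exists m; split=> //.
  elim: m Nm mmin {newm} => [|m IHm]; first by rewrite leqn0 => /eqP->.
  rewrite leq_eqVlt => /orP[/eqP<-//|]; rewrite ltnS => Nm mmin /=.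
  have nm : ~ new m D.
    by move=> newm; have := mmin m; rewrite Nm asboolT// ltnn => /(_ isT).
  rewrite asboolF// addn0 IHm// => j /mmin; exact: ltnW.
have cnt_surj k : exists N, cnt N D = k.
  elim: k => [|k [N cN]]; first by exists 0%N.
  have [n [newn cn]] := next N; exists n.+1 => /=.
  by rewrite asboolT// addn1 cn cN.
have iD k : new (i k D) D /\ cnt (i k D) D = k.
  have [_ iPk] := iP k; apply: iPk; have [N <-] := cnt_surj k.
  exact: next.
have cnt_inj n m : new n D -> new m D -> cnt n D = cnt m D -> n = m.
  move=> newn newm cnm; case: (ltngtP n m) => // nm.
    by have := cnt_lt _ _ _ newn nm; rewrite cnm ltnn.
  by have := cnt_lt _ _ _ newm nm; rewrite cnm ltnn.
have h_inj n m : new n D -> new m D -> h n D = h m D -> n = m.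
  move=> [vn newn] [vm newm] hnm; case: (ltngtP n m) => // nm.
    by have := newm (Ordinal nm); case.
  by have := newn (Ordinal nm); case.
split.
  move=> k l /h_inj ikl; have [nk ck] := iD k; have [nl cl] := iD l.
  by rewrite -ck -cl ikl.
move=> E; split=> [DE|[k <-]]; last by have [[]] := iD k.
have [n hn] := hP _ _ DE; have [|m newm hm] := newP n;
  first by rewrite /valid /= hn.
exists (cnt m D); rewrite -hn -hm; congr (h _ D).
by have [nk ck] := iD (cnt m D); exact: cnt_inj.
Qed.

(** * Cosets of open subgroups *)

Local Open Scope group_scope.

Lemma perm_funM (x y : Sinfty) a :
  perm_fun (x * y) a = perm_fun x (perm_fun y a).
Proof. by []. Qed.

Lemma perm_fun1 a : perm_fun (1 : Sinfty) a = a.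
Proof. by []. Qed.

Lemma perm_funK (x : Sinfty) : cancel (perm_fun x) (perm_fun x^-1).
Proof. by move=> a; rewrite -perm_funM mulVg perm_fun1. Qed.

Lemma perm_funVK (x : Sinfty) : cancel (perm_fun x^-1) (perm_fun x).
Proof. by move=> a; rewrite -perm_funM mulgV perm_fun1. Qed.

Lemma perm_extP (x y : Sinfty) :
  (forall a, perm_fun x a = perm_fun y a) -> x = y.
Proof. by move=> xy; apply: perm_fun_inj; exact/funext. Qed.

Definition lcos (g : Sinfty) (U : set Sinfty) : set Sinfty :=
  [set g * x | x in U].

Lemma lcosP g U x : lcos g U x <-> U (g^-1 * x).
Proof.
split=> [[u Uu <-]|Ux]; first by rewrite mulKg.
by exists (g^-1 * x) => //; rewrite mulVKg.
Qed.

Lemma lcosM g h U : lcos (g * h) U = lcos g (lcos h U).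
Proof.
by apply/seteqP; split=> x; rewrite !lcosP invgM mulgA.
Qed.

Lemma lcos1 U : lcos 1 U = U.
Proof. by apply/seteqP; split=> x; rewrite lcosP invg1 mul1g. Qed.

Section subgroup.
Variable G : set Sinfty.
Hypothesis sG : is_subgroup G.

Lemma subgroup1 : G 1.
Proof. by case: sG => G1 _; exact: set_mem G1. Qed.

Lemma subgroupV x : G x -> G x^-1.
Proof.
move=> Gx; case: sG => G1 GD.
by have := GD 1 x G1 (mem_set Gx); rewrite inE div1g.
Qed.

Lemma subgroupM x y : G x -> G y -> G (x * y).
Proof.
move=> Gx Gy; case: sG => _ GD.
have := GD x y^-1 (mem_set Gx) (mem_set (subgroupV Gy)).
by rewrite inE invgK.
Qed.

Lemma subgroupMl x y : G x -> G (x * y) <-> G y.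
Proof.
move=> Gx; split=> [Gxy|]; last exact: subgroupM.
by rewrite -(mulKg x y); apply: subgroupM => //; exact: subgroupV.
Qed.

Lemma eq_lcosP g h : lcos g G = lcos h G <-> G (g^-1 * h).
Proof.
split=> [gh|Ggh].
  by apply/lcosP; rewrite gh; apply/lcosP; rewrite mulVg; exact: subgroup1.
apply/seteqP; split=> x; rewrite !lcosP => Gx.
  rewrite -(subgroupMl _ Ggh); rewrite -mulgA mulVKg//.
by rewrite -(mulVKg h x) mulgA; exact: subgroupM.
Qed.

End subgroup.

Lemma open_subgroupP (G U : set Sinfty) : open_subgroup G U ->
  exists s : seq nat, forall g, G g ->
    (forall a, a \in s -> perm_fun g a = a) -> U g.
Proof.
move=> [sU UG [W oW UE]].
have /nbhs_SinftyP[p /basicP p1 pW] : nbhs (1 : Sinfty) W.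
  apply: open_nbhs_nbhs; split=> //.
  by have := subgroup1 sU; rewrite UE => -[].
exists (unzip1 p) => g Gg gs; rewrite UE; split=> //; apply: pW.
by apply/basicP => a b ab; rewrite gs ?(map_f fst ab)// -(p1 _ _ ab).
Qed.

Lemma open_subgroup_agree (G U : set Sinfty) :
  is_subgroup G -> open_subgroup G U ->
  exists s : seq nat, forall g h, G g -> G h ->
    (forall a, a \in s -> perm_fun g a = perm_fun h a) -> U (g^-1 * h).
Proof.
move=> sG /open_subgroupP[s sU]; exists s => g h Gg Gh gh; apply: sU.
  by apply: subgroupM => //; exact: subgroupV.
by move=> a sa; rewrite perm_funM -gh// perm_funK.
Qed.

Definition graph_on (s : seq nat) (g : Sinfty) :=
  [seq (a, perm_fun g a) | a <- s].

Lemma basic_graph_on s (g h : Sinfty) :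
  basic (graph_on s g) h <-> forall a, a \in s -> perm_fun h a = perm_fun g a.
Proof.
split=> [/basicP H a sa|H].
  by apply: H; apply/mapP; exists a.
by apply/basicP => a b /mapP[x sx [-> ->]]; exact: H.
Qed.

(** If [k] in the coset agrees with a limit point [h] on the finite set that
    controls [U], then [k^-1 h] is in [U]. *)
Lemma closed_lcos (G U : set Sinfty) g : is_subgroup G -> closed G ->
  open_subgroup G U -> G g -> closed (lcos g U).
Proof.
move=> sG cG oU Gg; have [s sU] := open_subgroup_agree sG oU.
have [sgU UG _] := oU.
apply: (closed_SinftyP _).2 => h hD; have [|k /lcosP Uk] := hD (graph_on s h).
  exact/basic_graph_on.
move/basic_graph_on => kh.
have Gh : G h.
  apply: (closed_SinftyP _).1 => // p /hD[x /lcosP /UG Ux px]; exists x => //.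
  by rewrite -(mulVKg g x); exact: subgroupM.
have Gk : G k by rewrite -(mulVKg g k); apply: subgroupM => //; exact: UG.
apply/lcosP; rewrite -(mulVKg k h) mulgA; apply: subgroupM => //.
exact: sU.
Qed.

(** * The action on the cosets of a neighbourhood basis *)

Definition top_group_basis (G : set Sinfty) (B : set (set Sinfty)) :=
  [/\ is_subgroup G, closed G, (forall U, B U -> open_subgroup G U) &
      nbhd_basis1 G B].

Definition coset_of_basis (G : set Sinfty) (B : set (set Sinfty)) :
    set (set Sinfty) :=
  [set C | exists g U, [/\ G g, B U & C = lcos g U]].

Section coset_action.
Variables (G : set Sinfty) (B : set (set Sinfty)) (c : nat -> set Sinfty).
Hypothesis GB : top_group_basis G B.
Hypothesis c_inj : injective c.
Hypothesis cE : forall C, coset_of_basis G B C <-> exists k, c k = C.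

Let sG : is_subgroup G. Proof. by case: GB. Qed.
Let cG : closed G. Proof. by case: GB. Qed.
Let oB U : B U -> open_subgroup G U. Proof. by case: GB => _ _ + _; exact. Qed.

(** Members of the basis are themselves cosets, and small members fix a given
    number. Faithfulness of the action and continuity of its inverse come from
    this. *)
Lemma basis_stabiliser x :
  exists2 a, B (c a) & forall u, c a u -> perm_fun u x = x.
Proof.
have [_ _ _ /(_ [set u | perm_fun u x = x])[+ _]] := GB.
case=> [|U BU Ux].
  have n1 : nbhs (1 : Sinfty) [set u : Sinfty | perm_fun u x = x].
    apply/nbhs_SinftyP; exists [:: (x, x)]; first by rewrite /basic /= eqxx.
    by move=> u /basicP; apply; rewrite mem_head.
  by apply: filterS n1 => u.
have /cE[a aU] : coset_of_basis G B U.
  by exists 1, U; split=> //; [exact: subgroup1|rewrite lcos1].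
by exists a; rewrite aU.
Qed.

Definition act (g : Sinfty) (a : nat) : nat :=
  xget 0%N [set b | c b = lcos g (c a)].

Lemma actP g a : G g -> c (act g a) = lcos g (c a).
Proof.
move=> Gg; have /cE[h [U [Gh BU ca]]] : exists k, c k = c a by exists a.
have /cE[b cb] : coset_of_basis G B (lcos g (c a)).
  by exists (g * h), U; rewrite ca lcosM; split=> //; exact: subgroupM.
by rewrite /act; case: xgetP => [_ _ ->//|/(_ b)].
Qed.

Lemma actM g h a : G g -> G h -> act (g * h) a = act g (act h a).
Proof.
move=> Gg Gh; apply: c_inj.
by rewrite !actP// ?lcosM//; exact: subgroupM.
Qed.

Lemma act1 a : act 1 a = a.
Proof. by apply: c_inj; rewrite actP ?lcos1//; exact: subgroup1. Qed.

Lemma act_bij g : G g -> bijective (act g).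
Proof.
move=> Gg; have GV := subgroupV sG Gg.
by exists (act g^-1) => a; rewrite -actM// ?mulVg ?mulgV act1.
Qed.

(** The placeholder 1 is used only for [g] outside of [G]. *)
Definition rho (g : Sinfty) : Sinfty :=
  if pselect (bijective (act g)) is left gb then mk_perm gb else 1.

Lemma rhoE g a : G g -> perm_fun (rho g) a = act g a.
Proof. by move=> Gg; rewrite /rho; case: pselect => // /(_ (act_bij Gg)). Qed.

Lemma rhoP g a b : G g -> perm_fun (rho g) a = b <-> lcos g (c a) = c b.
Proof.
move=> Gg; rewrite rhoE//; split=> [<-|gab]; first by rewrite actP.
by apply: c_inj; rewrite actP.
Qed.

Lemma rhoM g h : G g -> G h -> rho (g * h) = rho g * rho h.
Proof.
move=> Gg Gh; apply: perm_extP => a.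
by rewrite perm_funM !rhoE// ?actM//; exact: subgroupM.
Qed.

Lemma rho1 : rho 1 = 1.
Proof. by apply: perm_extP => a; rewrite rhoE ?act1//; exact: subgroup1. Qed.

Lemma rhoV g : G g -> rho g^-1 = (rho g)^-1.
Proof.
move=> Gg; apply: (mulgI (rho g)); rewrite mulgV -rhoM ?mulgV ?rho1//.
exact: subgroupV.
Qed.

(** The stabiliser in [G] of the coset [k U] is [k U k^-1], which is open. *)
Lemma rho_continuous g r : G g -> basic r (rho g) -> exists2 p, basic p g &
  forall h, G h -> basic p h -> basic r (rho h).
Proof.
move=> Gg; elim: r => [_|[a b] r IHr]; first by exists [::].
rewrite /basic /= => /andP[/eqP gab /IHr[p pg pr]].
have /cE[k [U [Gk BU ca]]] : exists k, c k = c a by exists a.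
have [s sU] := open_subgroup_agree sG (oB BU).
exists (graph_on [seq perm_fun k x | x <- s] g ++ p).
  by apply/basic_cat; split=> //; exact/basic_graph_on.
move=> h Gh /basic_cat[/basic_graph_on hg ph]; rewrite pr// andbT.
apply/eqP/rhoP => //; rewrite -((rhoP a b Gg).1 gab) ca -!lcosM.
have [sgU _ _] := oB BU.
apply/eq_lcosP => //; apply: sU; rewrite -1?perm_funM; do ?exact: subgroupM.
by move=> x sx; rewrite !perm_funM hg// map_f.
Qed.

(** If [U] fixes [x], the elements of the coset [g U] have the same value at
    [x]; the index of [U] is therefore the required one. *)
Lemma rho_point_open x : exists a, forall g h, G g -> G h ->
  perm_fun (rho g) a = perm_fun (rho h) a -> perm_fun g x = perm_fun h x.
Proof.
have [a Ba ax] := basis_stabiliser x; exists a => g h Gg Gh.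
have [sU _ _] := oB Ba.
move/(rhoP _ _ Gg) => E; have := (rhoP _ _ Gh).1 (erefl (perm_fun (rho h) a)).
rewrite -E => /esym/(eq_lcosP sU)/ax.
by rewrite perm_funM => /(congr1 (perm_fun g)); rewrite perm_funVK.
Qed.

Lemma rho_open g p : G g -> basic p g -> exists2 r, basic r (rho g) &
  forall h, G h -> basic r (rho h) -> basic p h.
Proof.
move=> Gg; elim: p => [_|[x y] p IHp]; first by exists [::].
rewrite /basic /= => /andP[/eqP gxy /IHp[r rg rp]].
have [a aP] := rho_point_open x.
exists ((a, perm_fun (rho g) a) :: r); first by rewrite /= eqxx.
by move=> h Gh /= /andP[/eqP ha rh]; rewrite rp// -gxy (aP h g)// eqxx.
Qed.

Lemma rho_inj g h : G g -> G h -> rho g = rho h -> g = h.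
Proof.
move=> Gg Gh gh; apply: perm_extP => x; have [a] := rho_point_open x.
by apply => //; rewrite gh.
Qed.

(** Let [U] be a member of the basis that fixes [x], with index [a]. If [alpha]
    is a limit of permutations [rho g], then [alpha a] determines the limit of
    the values [g x], and [alpha^-1 a] determines that of the values [g^-1 x].
    Both limits are needed for the limit function to be bijective; it belongs
    to [G] because [G] is closed. *)
Lemma rho_closed alpha : (forall r, basic r alpha -> hits (rho @` G) r) ->
  exists2 g, G g & rho g = alpha.
Proof.
move=> aG.
have near r : basic r alpha -> exists2 g, G g & basic r (rho g).
  by move=> /aG[_ [g Gg <-] rg]; exists g.
have img x : exists y, exists2 r, basic r alpha &
    forall h, G h -> basic r (rho h) -> perm_fun h x = y.
  have [a aP] := rho_point_open x.
  have [|g Gg /basicP ga] := near (graph_on [:: a] alpha).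
    exact/basic_graph_on.
  exists (perm_fun g x), (graph_on [:: a] alpha); first exact/basic_graph_on.
  move=> h Gh /basic_graph_on ha; apply: aP => //.
  by rewrite ha ?mem_head//; apply/esym/ga; rewrite mem_head.
have preimg y : exists x, exists2 r, basic r alpha &
    forall h, G h -> basic r (rho h) -> perm_fun h x = y.
  have [a aP] := rho_point_open y.
  pose r := [:: (perm_fun alpha^-1 a, a)].
  have ra : basic r alpha by rewrite /basic /= perm_funVK eqxx.
  have rV h : G h -> basic r (rho h) ->
      perm_fun (rho h^-1) a = perm_fun alpha^-1 a.
    move=> Gh /andP[/eqP/= ha _].
    by rewrite rhoV// -[in LHS]ha perm_funK.
  have [g Gg rg] := near r ra.
  exists (perm_fun g^-1 y), r => // h Gh rh.
  rewrite -[RHS](perm_funVK h); congr (perm_fun h _).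
  have [GV HV] := (subgroupV sG Gg, subgroupV sG Gh).
  by apply: aP => //; rewrite !rV.
have [f fP] := choice img; have [f' f'P] := choice preimg.
have fbij : bijective f.
  exists f' => x.
    have [[r ra rf] [r' r'a r'f]] := (fP x, f'P (f x)).
    have [|h Gh /basic_cat[rh r'h]] := near (r ++ r'); first exact/basic_cat.
    apply: (bij_inj (perm_fun_bij h)).
    by rewrite (rf h)// (r'f h).
  have [[r ra rf] [r' r'a r'f]] := (fP (f' x), f'P x).
  have [|h Gh /basic_cat[rh r'h]] := near (r ++ r'); first exact/basic_cat.
  by rewrite -(rf h Gh rh) (r'f h).
pose g := mk_perm fbij.
have gnear p : basic p g -> exists2 r, basic r alpha &
    forall h, G h -> basic r (rho h) -> basic p h.
  elim: p => [_|[x y] p IHp]; first by exists [::].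
  rewrite /basic /= => /andP[/eqP gxy /IHp[r rg rp]].
  have [r' r'a r'f] := fP x.
  exists (r' ++ r); first exact/basic_cat.
  by move=> h Gh /basic_cat[r'h rh]; rewrite rp// (r'f h)// -gxy eqxx.
have Gg : G g.
  apply: (closed_SinftyP _).1 => // p /gnear[r /near[h Gh rh] rp].
  by exists h => //; exact: rp.
exists g => //; apply: perm_extP => a.
have [|p pg pa] := @rho_continuous g (graph_on [:: a] (rho g)) Gg.
  exact/basic_graph_on.
have [r ra rp] := gnear p pg.
have [|h Gh /basic_cat[rh /basic_graph_on ha]] :=
  near (r ++ graph_on [:: a] alpha).
  by apply/basic_cat; split=> //; exact/basic_graph_on.
rewrite -ha ?mem_head//; have /basic_graph_on-> // := pa h Gh (rp h Gh rh).
exact: mem_head.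
Qed.

Lemma rho_closed_subgroup : is_subgroup (rho @` G) /\ closed (rho @` G).
Proof.
split; last first.
  by apply: (closed_SinftyP _).2 => a /rho_closed[g Gg <-]; exists g.
split; first by rewrite inE; exists 1; rewrite ?rho1//; exact: subgroup1.
move=> x y; rewrite !inE => -[g Gg <-] [h Gh <-].
exists (g * h^-1); first by apply: subgroupM => //; exact: subgroupV.
by rewrite rhoM ?rhoV//; exact: subgroupV.
Qed.

End coset_action.

(** * Isomorphisms and conjugating permutations *)

Lemma within_continuous_SinftyP (G : set Sinfty) (f : Sinfty -> Sinfty) :
  (forall g q, G g -> basic q (f g) -> exists2 p, basic p g &
     forall h, G h -> basic p h -> basic q (f h)) ->
  {within G, continuous f}.
Proof.
move=> H; apply/subspace_continuousP => g Gg A /nbhs_SinftyP[q qfg qA].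
have [p pg pq] := H _ _ Gg qfg.
apply/nbhs_SinftyP; exists p => // h ph Gh.
by apply: qA; exact: pq.
Qed.

Definition relabel (alpha : Sinfty) (r : seq (nat * nat)) :=
  [seq (perm_fun alpha x.1, perm_fun alpha x.2) | x <- r].

Lemma basic_relabel (alpha x : Sinfty) r :
  basic (relabel alpha r) (alpha * x * alpha^-1) <-> basic r x.
Proof.
rewrite /basic /= all_map; split=> /allP/= rx; apply/allP => -[a b] /rx /=;
  rewrite !perm_funM perm_funK.
  by move=> /eqP/(bij_inj (perm_fun_bij _))->.
by move=> /eqP->.
Qed.

Lemma relabelK (alpha : Sinfty) : cancel (relabel alpha^-1) (relabel alpha).
Proof.
move=> r; rewrite /relabel -map_comp -[RHS]map_id; apply: eq_map => -[a b] /=.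
by rewrite !perm_funVK.
Qed.

Lemma basic_relabelV (alpha x : Sinfty) r :
  basic r (alpha * x * alpha^-1) <-> basic (relabel alpha^-1 r) x.
Proof. by rewrite -[r in X in X <-> _](relabelK alpha) basic_relabel. Qed.

Lemma conj_setP (alpha : Sinfty) (G : set Sinfty) x :
  conj_set alpha G x <-> G (alpha^-1 * x * alpha).
Proof.
split=> [[y Gy <-]|Gx]; first by rewrite -!mulgA mulVg mulg1 mulKg.
by exists (alpha^-1 * x * alpha) => //; rewrite -!mulgA mulgV mulg1 mulVKg.
Qed.

Lemma conj_set_eqP (alpha : Sinfty) (G H : Effros Sinfty) :
  conj_set alpha G = H <-> forall r, hits G r <-> hits H (relabel alpha r).
Proof.
split=> [GH r|GH].
  split=> [[g Gg rg]|[h]].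
    exists (alpha * g * alpha^-1); last exact/basic_relabel.
    by rewrite -GH; exists g.
  rewrite -GH => -[g Gg <-] /basic_relabel rg; by exists g.
apply/seteqP; split=> x.
  move=> /conj_setP Gx.
  apply: (closed_SinftyP _).1 (@closed_effros _ H) _ _ => p.
  rewrite -(relabelK alpha p) => px; apply/GH;
    exists (alpha^-1 * x * alpha) => //.
  by apply/(basic_relabel alpha); rewrite -!mulgA mulgV mulg1 mulVKg.
move=> Hx; apply/conj_setP.
apply: (closed_SinftyP _).1 (@closed_effros _ G) _ _ => p.
move=> px; apply/GH; exists x => //.
by move/(basic_relabel alpha): px; rewrite -!mulgA mulgV mulg1 mulVKg.
Qed.

Lemma top_iso_sym (G H : set Sinfty) phi : is_subgroup G -> top_iso G H phi ->
  exists psi, [/\ top_iso H G psi, {in G, cancel phi psi} &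
                 {in H, cancel psi phi}].
Proof.
move=> sG [[fphi iphi sphi] mphi cphi [psi psiK cpsi]]; exists psi.
have psiV : {in H, cancel psi phi}.
  by move=> y /set_mem/sphi[x Gx <-]; rewrite psiK// inE.
have fpsi y : H y -> G (psi y).
  by move=> /sphi[x Gx <-]; rewrite psiK// inE.
split=> //; split=> //.
- split=> //.
    by move=> x y Hx Hy xy; rewrite -(psiV x)// xy psiV.
  by move=> x Gx; exists (phi x); [exact: fphi|rewrite psiK// inE].
- move=> x y /[dup] Hx' /set_mem Hx /[dup] Hy' /set_mem Hy.
  rewrite -[in LHS](psiV x)// -[in LHS](psiV y)// -mphi ?inE; do ?exact: fpsi.
  by rewrite psiK// inE; apply: subgroupM => //; exact: fpsi.
- by exists phi.
Qed.

Section coset_actions.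
Variables (G : set Sinfty) (B : set (set Sinfty)) (c : nat -> set Sinfty).
Hypothesis GB : top_group_basis G B.
Hypothesis c_inj : injective c.
Hypothesis cE : forall C, coset_of_basis G B C <-> exists k, c k = C.
Variables (H : set Sinfty) (B' : set (set Sinfty)) (d : nat -> set Sinfty).
Hypothesis HB : top_group_basis H B'.
Hypothesis d_inj : injective d.
Hypothesis dE : forall C, coset_of_basis H B' C <-> exists k, d k = C.

Let sG : is_subgroup G. Proof. by case: GB. Qed.
Let sH : is_subgroup H. Proof. by case: HB. Qed.

(** The map [phi] is the composition of [rho c], conjugation by [alpha] and the
    inverse of [rho d], which are all continuous. *)
Section intertwiner.
Variables (alpha : Sinfty) (phi : Sinfty -> Sinfty).
Hypothesis phiP :
  forall g, G g -> H (phi g) /\ rho d (phi g) = alpha * rho c g * alpha^-1.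

Lemma intertwiner_basic g q : G g -> basic q (phi g) -> exists2 p, basic p g &
  forall h, G h -> basic p h -> basic q (phi h).
Proof.
move=> Gg qg; have [Hg rg] := phiP Gg.
have [r rr rq] := rho_open HB d_inj dE Hg qg.
move: rr; rewrite rg => /basic_relabelV rr.
have [p pg pr] := rho_continuous GB c_inj cE Gg rr.
exists p => // h Gh ph; have [Hh rh] := phiP Gh.
by apply: rq => //; rewrite rh; apply/basic_relabelV; exact: pr.
Qed.

Lemma intertwiner_continuous : {within G, continuous phi}.
Proof. exact: within_continuous_SinftyP intertwiner_basic. Qed.

End intertwiner.

(** The isomorphism maps the coset [g U] to the coset [phi g (phi U)], and [phi
    U] is again a member of the basis. This induces a bijection of the indices
    that is compatible with the two actions. *)
Lemma iso_conj phi psi :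
  (forall g, G g -> H (phi g)) -> (forall h, H h -> G (psi h)) ->
  {in G, cancel phi psi} -> {in H, cancel psi phi} ->
  {in G &, {morph phi : x y / x * y}} -> {in H &, {morph psi : x y / x * y}} ->
  (forall U, B U -> B' (phi @` U)) -> (forall U, B' U -> B (psi @` U)) ->
  exists alpha : Sinfty, (forall a, d (perm_fun alpha a) = phi @` c a) /\
     conj_set alpha (rho c @` G) = rho d @` H.
Proof.
move=> phiH psiG phiK psiK phiM psiM phiB psiB.
have img_lcos (K : set Sinfty) f g U : {in K &, {morph f : x y / x * y}} ->
    K g -> U `<=` K -> f @` lcos g U = lcos (f g) (f @` U).
  move=> fM Kg UK.
  apply/seteqP; split=> [_ [_ [u Uu <-] <-]|_ [_ [u Uu <-] <-]].
    by exists (f u); [exists u|rewrite fM// inE//; exact: UK].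
  by exists (g * u); [exists u|rewrite fM// inE//; exact: UK].
have c_sub a : c a `<=` G.
  have /cE[k [U [Gk BU ->]]] : exists k, c k = c a by exists a.
  move=> _ [u Uu <-]; apply: subgroupM => //.
  by case: GB => _ _ /(_ U BU)[_ + _] _; exact.
have d_sub a : d a `<=` H.
  have /dE[k [U [Gk BU ->]]] : exists k, d k = d a by exists a.
  move=> _ [u Uu <-]; apply: subgroupM => //.
  by case: HB => _ _ /(_ U BU)[_ + _] _; exact.
have /choice[f fP] a : exists b, d b = phi @` c a.
  apply/dE; have /cE[g [U [Gg BU ->]]] : exists k, c k = c a by exists a.
  exists (phi g), (phi @` U); split; [exact: phiH|exact: phiB|].
  by apply: (img_lcos G) => //; case: GB => _ _ /(_ U BU)[_ + _] _; exact.
have /choice[f' f'P] a : exists b, c b = psi @` d a.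
  apply/cE; have /dE[g [U [Gg BU ->]]] : exists k, d k = d a by exists a.
  exists (psi g), (psi @` U); split; [exact: psiG|exact: psiB|].
  by apply: (img_lcos H) => //; case: HB => _ _ /(_ U BU)[_ + _] _; exact.
have fbij : bijective f.
  exists f' => a.
    apply: c_inj; rewrite f'P fP image_comp -[RHS]image_id.
    by apply: eq_imagel => x /c_sub Gx /=; rewrite phiK// inE.
  apply: d_inj; rewrite fP f'P image_comp -[RHS]image_id.
  by apply: eq_imagel => x /d_sub Hx /=; rewrite psiK// inE.
pose alpha := mk_perm fbij.
have rhoC g : G g -> rho d (phi g) = alpha * rho c g * alpha^-1.
  move=> Gg; apply: (mulIg alpha); rewrite -[RHS]mulgA mulVg mulg1.
  apply: perm_extP => a; rewrite !perm_funM.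
  apply/(rhoP HB d_inj dE); first exact: phiH.
  have cga : lcos g (c a) = c (perm_fun (rho c g) a).
    exact/(rhoP GB c_inj cE).
  rewrite [d _]fP [X in _ = X]fP -cga; apply/esym.
  by apply: (img_lcos G) => //; exact: c_sub.
exists alpha; split=> //.
apply/seteqP; split=> [_ [_ [g Gg <-] <-]|_ [h Hh <-]].
  by exists (phi g); [exact: phiH|exact: rhoC].
exists (rho c (psi h)); first by exists (psi h) => //; exact: psiG.
by rewrite -rhoC; [rewrite psiK// inE|exact: psiG].
Qed.

End coset_actions.

Lemma conj_iso (G : set Sinfty) (B : set (set Sinfty)) (c : nat -> set Sinfty)
    (H : set Sinfty) (B' : set (set Sinfty)) (d : nat -> set Sinfty) alpha :
  top_group_basis G B -> injective c ->
  (forall C, coset_of_basis G B C <-> exists k, c k = C) ->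
  top_group_basis H B' -> injective d ->
  (forall C, coset_of_basis H B' C <-> exists k, d k = C) ->
  conj_set alpha (rho c @` G) = rho d @` H ->
  exists2 phi, top_iso G H phi &
    forall g, G g -> H (phi g) /\ rho d (phi g) = alpha * rho c g * alpha^-1.
Proof.
move=> GB c_inj cE HB d_inj dE GH.
have [sG _ _ _] := GB; have [sH _ _ _] := HB.
have /choice[phi phiP] g : exists h, G g ->
    H h /\ rho d h = alpha * rho c g * alpha^-1.
  have [Gg|nGg] := pselect (G g); last by exists 1.
  have : (rho d @` H) (alpha * rho c g * alpha^-1).
    by rewrite -GH; exists (rho c g) => //; exists g.
  by move=> [h Hh hg]; exists h.
have /choice[psi psiP] h : exists g, H h ->
    G g /\ rho c g = alpha^-1 * rho d h * alpha^-1^-1.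
  have [Hh|nHh] := pselect (H h); last by exists 1.
  have : conj_set alpha (rho c @` G) (rho d h) by rewrite GH; exists h.
  move=> /conj_setP[g Gg hg]; exists g => _; split=> //.
  by rewrite invgK.
have phiK : {in G, cancel phi psi}.
  move=> g /set_mem Gg; have [Hg gP] := phiP g Gg; have [Gg' g'P] := psiP _ Hg.
  apply: (rho_inj GB c_inj cE) => //.
  by rewrite g'P gP invgK -!mulgA mulVg mulg1 mulKg.
have psiK : {in H, cancel psi phi}.
  move=> h /set_mem Hh; have [Gh hP] := psiP h Hh; have [Hh' h'P] := phiP _ Gh.
  apply: (rho_inj HB d_inj dE) => //.
  by rewrite h'P hP invgK -!mulgA mulgV mulg1 mulVKg.
exists phi => //; split.
- split=> [g /phiP[]//|g g' Gg Gg' gg'|h Hh].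
    by rewrite -(phiK g)// gg' phiK.
  by exists (psi h); [have [] := psiP h Hh|rewrite psiK// inE].
- move=> g h /set_mem Gg /set_mem Gh.
  have Ggh := subgroupM sG Gg Gh.
  have [[[Hg gP] [Hh hP]] [Hgh ghP]] := (phiP _ Gg, phiP _ Gh, phiP _ Ggh).
  apply: (rho_inj HB d_inj dE) => //; first exact: subgroupM.
  rewrite ghP (rhoM GB c_inj cE)// (rhoM HB d_inj dE)// gP hP.
  by rewrite -!mulgA mulKg.
- exact: (intertwiner_continuous GB c_inj cE HB d_inj dE phiP).
- exists psi => //.
  exact: (intertwiner_continuous HB d_inj dE GB c_inj cE psiP).
Qed.

(** * Borel functions on a set *)

(** The sets whose preimage has a Borel trace on [D] form a sigma-algebra, and
    each generator is a countable union of members of the base. *)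
Lemma borel_on_base d1 d2 (X : measurableType d1) (Y : measurableType d2)
    (gen : set (set Y)) (I : countType) (W : I -> set Y)
    (D : set X) (f : X -> Y) :
  measurable = <<s gen >> ->
  (forall B y, gen B -> B y -> exists2 i, W i y & W i `<=` B) ->
  (forall i, exists2 A, measurable A & forall x, D x -> W i (f x) <-> A x) ->
  borel_on D f.
Proof.
move=> genE base /(_ _)/cid2-/all_sig2[A mA AP].
pose traced := [set B : set Y |
  exists2 A, measurable A & D `&` f @^-1` B = D `&` A].
suff sub : <<s gen >> `<=` traced by move=> B; rewrite genE => /sub.
apply: smallest_sub; first split.
- by exists set0 => //; rewrite preimage_set0.
- move=> B [A' mA' BA']; exists (~` A'); first exact: measurableC.
  apply/seteqP; split=> x [Dx nB]; split=> //.
    move=> A'x; apply: nB.2; suff : (D `&` f @^-1` B) x by case.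
    by rewrite BA'.
  split=> // Bx; apply: nB; suff : (D `&` A') x by case.
  by rewrite -BA'.
- move=> F FP; have /choice[A' A'P] n : exists A', measurable A' /\
      D `&` f @^-1` (F n) = D `&` A'.
    by have [A' ? ?] := FP n; exists A'.
  exists (\bigcup_n A' n).
    by apply: bigcupT_measurable => n; have [] := A'P n.
  rewrite preimage_bigcup !setI_bigcupr; apply: eq_bigcupr => n _.
  by have [] := A'P n.
move=> B genB; exists [set x | exists i, W i `<=` B /\ A i x].
  apply: measurable_exP => i.
  exact: measurable_andP (measurable_cstP _ _) (mA i).
apply/seteqP; split=> x [Dx] /=.
  move=> /(base _ _ genB)[i Wi WiB]; split=> //; exists i; split=> //.
  exact/AP.
by move=> [i [WiB Aix]]; split=> //; apply: WiB; exact/AP.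
Qed.

Lemma borel_on_effros d (X : measurableType d) (D : set X)
    (f : X -> Effros Sinfty) :
  (forall p, exists2 A, measurable A & forall x, D x -> hits (f x) p <-> A x) ->
  borel_on D f.
Proof.
move=> H; apply: (@borel_on_base _ _ X (Effros Sinfty) (@effros_system Sinfty)
  (seq (nat * nat)) (fun p => [set E : Effros Sinfty | hits E p])) => //.
move=> _ E [U oU <-] /= [g [Eg Ug]].
have [p pU pg] : (\bigcup_(p in [set p | basic p `<=` U]) basic p) g.
  by rewrite -open_Sinfty_bigcup.
exists p; first by exists g.
by move=> F [h Fh /pU Uh]; exists h.
Qed.

Lemma borel_on_Sinfty d (X : measurableType d) (D : set X)
    (f : X -> Borel Sinfty) :
  (forall a b, exists2 A, measurable A &
     forall x, D x -> perm_fun (f x) a = b <-> A x) ->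
  borel_on D f.
Proof.
move=> H; apply: (@borel_on_base _ _ X (Borel Sinfty) (@open Sinfty)
  (seq (nat * nat)) basic) => //.
  move=> U g oU Ug.
  have /nbhs_SinftyP[p pg pU] : nbhs (g : Sinfty) U by exact: open_nbhs_nbhs.
  by exists p.
elim=> [|[a b] p [A mA AP]]; first by exists setT.
have [A' mA' A'P] := H a b; exists (A' `&` A); first exact: measurableI.
move=> x Dx; rewrite /basic /= -(rwP andP) -(rwP eqP) A'P//.
by rewrite -AP.
Qed.

Definition hits2 (D : set (Sinfty * Sinfty)) p q :=
  exists2 z, D z & basic p z.1 /\ basic q z.2.

Lemma nbhs_basic2 (z : Sinfty * Sinfty) (A : set (Sinfty * Sinfty)) :
  nbhs z A ->
  exists p q, [/\ basic p z.1, basic q z.2 &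
     forall w, basic p w.1 -> basic q w.2 -> A w].
Proof.
move=> [[P Q] /= [/nbhs_SinftyP[p pz pP] /nbhs_SinftyP[q qz qQ]] PQA].
by exists p, q; split=> // w pw qw; apply: PQA; split; [exact: pP|exact: qQ].
Qed.

Lemma open_basic2 p q :
  open [set z : Sinfty * Sinfty | basic p z.1 /\ basic q z.2].
Proof.
rewrite openE => z [pz qz]; exists (basic p, basic q) => //=.
by split; apply/nbhs_SinftyP; [exists p|exists q].
Qed.

Lemma measurable_hits2 p q :
  measurable [set D : Effros (Sinfty * Sinfty)%type | hits2 D p q].
Proof.
rewrite (_ : [set D | _] = [set D : Effros (Sinfty * Sinfty)%type |
   (D : set (Sinfty * Sinfty)%type) `&`
     [set z | basic p z.1 /\ basic q z.2] !=set0]).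
  by apply: measurable_effros_open; exact: open_basic2.
by apply/seteqP; split=> D [z]; [exists z|case=> Dz pz; exists z].
Qed.

Lemma borel_on_effros2 d (X : measurableType d) (D : set X)
    (f : X -> Effros (Sinfty * Sinfty)%type) :
  (forall p q, exists2 A, measurable A &
     forall x, D x -> hits2 (f x) p q <-> A x) ->
  borel_on D f.
Proof.
move=> H; apply: (@borel_on_base _ _ X (Effros (Sinfty * Sinfty)%type)
  (@effros_system (Sinfty * Sinfty)%type)
  (seq (nat * nat) * seq (nat * nat))%type
  (fun pq => [set E : Effros (Sinfty * Sinfty)%type | hits2 E pq.1 pq.2]));
  [by []| |by move=> pq; exact: H].
move=> _ E [U oU <-] /= [z [Ez Uz]].
have [p [q [pz qz pqU]]] : exists p q, [/\ basic p z.1, basic q z.2 &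
     forall w, basic p w.1 -> basic q w.2 -> U w].
  by apply: nbhs_basic2; exact: open_nbhs_nbhs.
exists (p, q); first by exists z.
by move=> F [w Fw [pw qw]]; exists w; split=> //; exact: pqU.
Qed.

(** * Products and quotients of sets of permutations *)

(** A triple [(a, b, e)] stands for [y] sending [a] to [b] and [x] sending [b]
    to [e], so that [x * y] sends [a] to [e]. Lists of triples turn inclusions
    between products of sets of permutations into countable conditions on the
    basic open sets that they meet. *)
Section triples.
Implicit Types u : seq (nat * nat * nat).

Definition lft u := [seq (x.1.1, x.1.2) | x <- u].
Definition rgt u := [seq (x.1.2, x.2) | x <- u].
Definition out u := [seq (x.1.1, x.2) | x <- u].

Lemma basic_out u (x y : Sinfty) :
  basic (lft u) y -> basic (rgt u) x -> basic (out u) (x * y).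
Proof.
rewrite /basic /= !all_map => /allP ly /allP rx;
  apply/allP => -[[a b] e] /= /[dup].
by move=> /ly /= /eqP ya /rx /= /eqP xb; rewrite perm_funM ya xb.
Qed.

Lemma basic_lft u (x y : Sinfty) :
  basic (out u) y -> basic (rgt u) x -> basic (lft u) (x^-1 * y).
Proof.
rewrite /basic /= !all_map => /allP ly /allP rx;
  apply/allP => -[[a b] e] /= /[dup].
by move=> /ly /= /eqP ya /rx /= /eqP xb; rewrite perm_funM ya -xb perm_funK.
Qed.

Lemma mul_subP (A B D : set Sinfty) : closed D ->
  (forall x y, A x -> B y -> D (x * y)) <->
  forall u, hits B (lft u) -> hits A (rgt u) -> hits D (out u).
Proof.
move=> cD; split=> [ABD u [y By ly] [x Ax rx]|ABD x y Ax By].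
  by exists (x * y); [exact: ABD|exact: basic_out].
apply: (closed_SinftyP _).1 => // p pxy.
pose u := [seq (ab.1, perm_fun y ab.1, ab.2) | ab <- p].
rewrite (_ : p = out u); last first.
  by rewrite /out -map_comp -[LHS]map_id; apply: eq_map => -[].
apply: ABD; [exists y|exists x] => //; rewrite /basic /= !all_map;
  apply/allP => -[a b].
  by rewrite /= eqxx.
by move=> /((allP pxy) _).
Qed.

Lemma divl_subP (A B D : set Sinfty) : closed D ->
  (forall x y, A x -> B y -> D (x^-1 * y)) <->
  forall u, hits B (out u) -> hits A (rgt u) -> hits D (lft u).
Proof.
move=> cD; split=> [ABD u [y By ly] [x Ax rx]|ABD x y Ax By].
  by exists (x^-1 * y); [exact: ABD|exact: basic_lft].
apply: (closed_SinftyP _).1 => // p pxy.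
pose u := [seq (ab, perm_fun y ab.1) | ab <- p].
rewrite (_ : p = lft u); last first.
  by rewrite /lft -map_comp -[LHS]map_id; apply: eq_map => -[].
apply: ABD; [exists y|exists x] => //; rewrite /basic /= !all_map;
  apply/allP => -[a b].
  by rewrite /= eqxx.
move=> /((allP pxy) _) /=; rewrite perm_funM => /eqP <-.
by rewrite perm_funVK.
Qed.

End triples.

Lemma hits_closure (A : set Sinfty) p : hits (closure A) p <-> hits A p.
Proof.
split=> [[g Ag pg]|[g Ag pg]]; last by exists g => //; exact: subset_closure.
have [|h [Ah ph]] := Ag (basic p); first by apply/nbhs_SinftyP; exists p.
by exists h.
Qed.

(** The closure makes this total. For a left coset of a closed subgroup, the
    quotient set is already closed and is that subgroup. *)
Definition quot (C : Effros Sinfty) : Effros Sinfty :=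
  mk_effros (@closed_closure _
    [set x^-1 * y | x in (C : set Sinfty) & y in (C : set Sinfty)]).

Lemma hits_quot C p :
  hits (quot C) p <-> exists u, lft u = p /\ (hits C (out u) /\ hits C (rgt u)).
Proof.
rewrite hits_closure.
split=> [[_ [x Cx [y Cy <-]] pxy]|[u [<- [[y Cy oy] [x Cx rx]]]]].
  exists [seq (ab, perm_fun y ab.1) | ab <- p]; split.
    by rewrite /lft -map_comp -[RHS]map_id; apply: eq_map => -[].
  split; [exists y|exists x] => //; rewrite /basic /= !all_map;
    apply/allP => -[a b].
    by rewrite /= eqxx.
  move=> /((allP pxy) _) /=; rewrite perm_funM => /eqP <-.
  by rewrite perm_funVK.
by exists (x^-1 * y); [exists x => //; exists y|exact: basic_lft].
Qed.

Lemma measurable_quot : measurable_fun setT quot.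
Proof.
apply: measurable_effrosP => p.
rewrite (_ : [set C | _] = [set C : Effros Sinfty | exists u, lft u = p /\
    (hits C (out u) /\ hits C (rgt u))]); last first.
  by apply/seteqP; split=> C /= /hits_quot.
apply: measurable_exP => u; apply: measurable_andP;
  first exact: measurable_cstP.
by apply: measurable_andP; exact: measurable_hits.
Qed.

Lemma quot_lcos (U : set Sinfty) g (C : Effros Sinfty) :
  is_subgroup U -> closed U -> C = lcos g U :> set Sinfty ->
  quot C = U :> set Sinfty.
Proof.
move=> sU /closure_id cU CE; rewrite /quot mk_effrosE [RHS]cU; congr closure.
apply/seteqP; split=> [_ [x + [y + <-]]|u Uu].
  rewrite CE => -[u Uu <-] [v Uv <-]; rewrite invgM -mulgA mulKg.
  by apply: subgroupM => //; exact: subgroupV.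
have [Cg Cgu] : (C : set Sinfty) g /\ (C : set Sinfty) (g * u).
  rewrite CE; split; last by exists u.
  by exists 1; [exact: subgroup1|rewrite mulg1].
by exists g => //; exists (g * u) => //; rewrite mulKg.
Qed.

Lemma closed_open_subgroup (G U : set Sinfty) : is_subgroup G -> closed G ->
  open_subgroup G U -> closed U.
Proof.
by move=> sG cG oU; rewrite -[U]lcos1; apply: closed_lcos oU _ => //;
  exact: subgroup1.
Qed.

(** * Borel enumeration of the cosets *)

Lemma coset_inner_basic (G : set Sinfty) (B : set (set Sinfty))
    (C : set Sinfty) g :
  is_subgroup G -> (forall U, B U -> open_subgroup G U) ->
  coset_of_basis G B C -> C g ->
  exists2 p, basic p g & forall h, G h -> basic p h -> C h.
Proof.
move=> sG oG [k [U [Gk NU ->]]] /lcosP Ukg; have oU := oG U NU;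
  have [sU UG _] := oU.
have Gg : G g by rewrite -(mulVKg k g); apply: subgroupM => //; exact: UG.
have [s sUP] := open_subgroup_agree sG oU.
exists (graph_on s g); first exact/basic_graph_on.
move=> h Gh /basic_graph_on hg; apply/lcosP.
rewrite -(mulVKg g h) mulgA; apply: subgroupM => //.
by apply: sUP => // a sa; rewrite hg.
Qed.

Section cosets.
Variables (V : set (Effros Sinfty)) (N : Effros Sinfty -> set (set Sinfty)).
Hypothesis V_sub : V `<=` closed_subgroups.
Hypothesis N_count : forall G, V G -> (N G #= [set: nat])%card.
Hypothesis N_open : forall G U, V G -> N G U -> open_subgroup G U.
Hypothesis N_basis : forall G, V G -> nbhd_basis1 G (N G).
Hypothesis T_borel : measurable
  [set p : Effros Sinfty * Effros Sinfty | V p.1 /\ N p.1 p.2].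

(** A nonempty [C] is a left coset of the subgroup [quot C] if and only if [C
    (quot C)] is included in [C]; by [mul_subP], this is the last clause. *)
Definition coset_rel : set (Effros Sinfty * Effros Sinfty) := [set p |
  (V p.1 /\ N p.1 (quot p.2)) /\ (hits p.2 [::] /\
  ((forall r, hits p.2 r -> hits p.1 r) /\
   forall u, hits (quot p.2) (lft u) -> hits p.2 (rgt u) -> hits p.2 (out u)))].

Lemma measurable_coset_rel : measurable coset_rel.
Proof.
have m1 p : measurable [set x : Effros Sinfty * Effros Sinfty | hits x.1 p].
  by apply: measurable_hitsT; exact: measurable_fst.
have m2 p : measurable [set x : Effros Sinfty * Effros Sinfty | hits x.2 p].
  by apply: measurable_hitsT; exact: measurable_snd.
have mq :
    measurable_fun setT (fun x : Effros Sinfty * Effros Sinfty => quot x.2).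
  exact: measurableT_comp measurable_quot measurable_snd.
have mqp p :
    measurable [set x : Effros Sinfty * Effros Sinfty | hits (quot x.2) p].
  exact: measurable_hitsT.
apply: measurable_andP.
  have := measurable_fun_pair
    (@measurable_fst _ _ (Effros Sinfty) (Effros Sinfty)) mq.
  by move=> /(_ measurableT _ T_borel); rewrite setTI.
apply: measurable_andP => //; apply: measurable_andP.
  by apply: measurable_allP => r; exact: measurable_impP.
by apply: measurable_allP => u; apply: measurable_impP => //;
  exact: measurable_impP.
Qed.

Section member.
Variables (G : Effros Sinfty) (VG : V G).

Lemma V_group_basis : top_group_basis G (N G).
Proof.
split; [exact: V_sub|exact: closed_effros| |exact: N_basis].
by move=> U; exact: N_open.
Qed.

Let sG : is_subgroup G. Proof. exact: V_sub. Qed.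

Lemma coset_relP C : coset_rel (G, C) <-> coset_of_basis G (N G) C.
Proof.
split=> [[/= [_ NC] [[g Cg _] [CG]]]|[g [U [Gg NU CE]]]].
  have cC := @closed_effros _ C.
  move=> /(mul_subP _ _ cC) CM.
  have {}CG : (C : set Sinfty) `<=` (G : set Sinfty).
    move=> x Cx; apply: (closed_SinftyP _).1 (@closed_effros _ G) _ _ => p px.
    by apply: CG; exists x.
  exists g, (quot C); split=> //; first exact: CG.
  apply/seteqP; split=> [x Cx|_ [u Uu <-]]; last exact: CM.
  apply/lcosP; apply: subset_closure.
  by exists g => //; exists x.
have oU := N_open VG NU; have [sU UG _] := oU.
have cU : closed U := closed_open_subgroup sG (@closed_effros _ G) oU.
have QU := quot_lcos sU cU CE.
split; first by split=> //=; rewrite QU.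
split=> /=.
  by exists g => //; rewrite CE; exists 1; [exact: subgroup1|rewrite mulg1].
split=> [r [x]|].
  rewrite CE => -[u Uu <-] pgu; exists (g * u) => //.
  by apply: subgroupM => //; exact: UG.
apply/(mul_subP _ _ (@closed_effros _ C)) => x y.
rewrite QU CE => -[u Uu <-] Uy; exists (u * y); last by rewrite mulgA.
exact: subgroupM.
Qed.

Lemma coset_closed (C : set Sinfty) : coset_of_basis G (N G) C -> closed C.
Proof.
move=> [k [U [Gk NU ->]]].
exact: closed_lcos sG (@closed_effros _ G) (N_open VG NU) Gk.
Qed.

Lemma infinite_cosets : infinite_set [set C | coset_rel (G, C)].
Proof.
move=> finC.
have : finite_set (N G).
  apply: (@sub_finite_set _ _
    ((@effros_set Sinfty) @` [set C | coset_rel (G, C)])).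
    move=> U NU; have oU := N_open VG NU.
    have cU : closed U := closed_open_subgroup sG (@closed_effros _ G) oU.
    exists (mk_effros cU) => //=; apply/coset_relP.
    by exists 1, U; split=> //; [exact: subgroup1|rewrite lcos1].
  exact: finite_image.
by rewrite (eq_finite_set (N_count VG)) => /infinite_nat.
Qed.

End member.

(** A coset [C] contains the trace on [G] of some basic open set that meets
    [G]. This basic open set and the subgroup [quot C] determine [C]. *)
Lemma countable_cosets G : countable [set C | coset_rel (G, C)].
Proof.
have [VG|nVG] := pselect (V G); last first.
  rewrite (_ : [set C | _] = set0); first exact: countable0.
  by rewrite -subset0 => C [[]].
have sG : is_subgroup G by exact: V_sub.
have /countable_injP[f finj] : countable (N G).
  by rewrite (eq_countable (N_count VG)).
have /choice[p pP] C : exists p, coset_rel (G, C) -> hits G p /\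
    forall h, (G : set Sinfty) h -> basic p h -> (C : set Sinfty) h.
  have [rC|nrC] := pselect (coset_rel (G, C)); last by exists [::].
  have [_ [[g Cg _] _]] := rC.
  have [p pg pC] :=
    coset_inner_basic sG (fun U => @N_open G U VG) ((coset_relP VG C).1 rC) Cg.
  exists p => _; split=> //; exists g => //.
  have [_ [_ [CG _]]] := rC.
  apply: (closed_SinftyP _).1 (@closed_effros _ G) _ _ => q qg.
  by apply: CG; exists g.
apply/countable_injP; exists (fun C => pickle (f (quot C), p C)) => C D.
rewrite !inE => rC rD /(pcan_inj pickleK)[fCD pCD].
have [[[_ NC] _] [[_ ND] _]] := (rC, rD).
have QCD : quot C = quot D :> set Sinfty by apply: finj; rewrite ?inE.
have [[g Gg pg] pC] := pP C rC; have [_ pD] := pP D rD.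
have Cg := pC g Gg pg; have Dg : (D : set Sinfty) g by apply: pD; rewrite -?pCD.
have coset E : coset_rel (G, E) -> (E : set Sinfty) g ->
    E = lcos g (quot E) :> set Sinfty.
  move=> rE Eg; have /(coset_relP VG)[k [U [Gk NU EE]]] := rE.
  have oU := N_open VG NU; have [sU _ _] := oU.
  have cU : closed U := closed_open_subgroup sG (@closed_effros _ G) oU.
  rewrite (quot_lcos sU cU EE) [LHS]EE; apply/(eq_lcosP sU).
  by apply/lcosP; rewrite -EE.
by apply: effros_inj; rewrite (coset C)// (coset D)// QCD.
Qed.

Lemma coset_enumeration : exists c : nat -> Effros Sinfty -> Effros Sinfty,
  (forall k, measurable_fun setT (c k)) /\
  forall G, V G -> injective (fun k => c k G : set Sinfty) /\
    forall C, coset_of_basis G (N G) C <-> exists k, c k G = C :> set Sinfty.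
Proof.
have [c [mc cP]] := effros_enumeration measurable_coset_rel countable_cosets.
exists c; split=> // G VG; have [cinj cE] := cP G (infinite_cosets VG).
split=> [k l /effros_inj/cinj//|C]; split=> [GC|[k <-]].
  have /cE[k ck] : coset_rel (G, mk_effros (coset_closed VG GC)).
    exact/coset_relP.
  by exists k; rewrite ck.
by apply/(coset_relP VG); apply/cE; exists k.
Qed.

End cosets.

(** * The Borel reduction to conjugacy *)

Section reduction.
Variables (V : set (Effros Sinfty)) (N : Effros Sinfty -> set (set Sinfty)).
Hypothesis V_basis : forall G, V G -> top_group_basis G (N G).
Variable c : nat -> Effros Sinfty -> Effros Sinfty.
Hypothesis c_measurable : forall k, measurable_fun setT (c k).
Hypothesis c_inj : forall G, V G -> injective (fun k => c k G : set Sinfty).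
Hypothesis cE : forall G, V G -> forall C,
  coset_of_basis G (N G) C <-> exists k, c k G = C :> set Sinfty.

Let cs (G : Effros Sinfty) : nat -> set Sinfty := fun k => c k G.

(** By [movesP], the elements of [G] in [basic p] send the coset [a] to the
    coset [b]. One inclusion does not suffice, since a left coset may be
    properly included in a left coset of a larger subgroup. *)
Definition moves (G : Effros Sinfty) p a b :=
  (forall u, hits (c a G) (lft u) -> hits G (p ++ rgt u) ->
    hits (c b G) (out u)) /\
  (forall u, hits (c b G) (out u) -> hits G (p ++ rgt u) ->
    hits (c a G) (lft u)).

Lemma measurable_moves d (X : measurableType d) (f : X -> Effros Sinfty) p a b :
  measurable_fun setT f -> measurable [set x | moves (f x) p a b].
Proof.
move=> mf.
have mh r : measurable [set x | hits (f x) r] by exact: measurable_hitsT.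
have mc k r : measurable [set x | hits (c k (f x)) r].
  by apply: measurable_hitsT; exact: measurableT_comp (c_measurable k) mf.
by apply: measurable_andP; apply: measurable_allP => u;
  do ?apply: measurable_impP.
Qed.

Lemma hitsI (G : set Sinfty) p r : hits G (p ++ r) <-> hits (G `&` basic p) r.
Proof.
by split=> [[g Gg /basic_cat[pg rg]]|[g [Gg pg] rg]]; exists g => //;
  exact/basic_cat.
Qed.

Lemma movesP G p a b : V G -> moves G p a b <->
  forall g, (G : set Sinfty) g -> basic p g -> lcos g (cs G a) = cs G b.
Proof.
move=> VG; have [ca cb] := (@closed_effros _ (c a G), @closed_effros _ (c b G)).
have mulP := mul_subP (G `&` basic p) (c a G) cb.
have divP := divl_subP (G `&` basic p) (c b G) ca.
split=> [[/= M D] g Gg pg|M].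
  apply/seteqP; split=> [_ [x ax <-]|x bx].
    apply: (mulP.2 _ g x) => //.
    by move=> u la /hitsI; exact: M.
  apply/lcosP; apply: (divP.2 _ g x) => //.
  by move=> u la /hitsI; exact: D.
split=> u la /hitsI ru.
  apply: (mulP.1 _ u la ru) => x y [Gx px] ay.
  by rewrite -[_ _ _]/(cs G b _) -(M x)//; exists y.
apply: (divP.1 _ u la ru) => x y [Gx px].
by rewrite -[_ _ y]/(cs G b y) -(M x)// => /lcosP.
Qed.

Definition hat (G : Effros Sinfty) : Effros Sinfty :=
  mk_effros (@closed_closure _ (rho (cs G) @` (G : set Sinfty))).

Lemma hatE G : V G -> hat G = rho (cs G) @` (G : set Sinfty) :> set Sinfty.
Proof.
move=> VG; apply/esym/closure_id.
by have [] := rho_closed_subgroup (V_basis VG) (c_inj VG) (cE VG).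
Qed.

Lemma hat_closed_subgroup G : V G -> closed_subgroups (hat G).
Proof.
move=> VG; rewrite /closed_subgroups /= hatE//.
by have [] := rho_closed_subgroup (V_basis VG) (c_inj VG) (cE VG).
Qed.

Lemma rho_basicP G p r : V G ->
  (forall g, (G : set Sinfty) g -> basic p g -> basic r (rho (cs G) g)) <->
  forall ab, ab \in r -> moves G p ab.1 ab.2.
Proof.
move=> VG; split=> [H [a b] ab|H g Gg pg].
  apply/movesP => // g Gg pg.
  apply/(rhoP (V_basis VG) (c_inj VG) (cE VG)) => //.
  by move/basicP: (H g Gg pg) => /(_ _ _ ab).
apply/basicP => a b ab; apply/(rhoP (V_basis VG) (c_inj VG) (cE VG)) => //.
by have /movesP := H _ ab; apply.
Qed.

(** The condition on [g] that [rho g] belongs to a basic open set is open, so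
    it can be tested on basic open sets of [G]. *)
Lemma hits_hat G r : V G -> hits (hat G) r <->
  exists p, hits G p /\ forall ab, ab \in r -> moves G p ab.1 ab.2.
Proof.
move=> VG; rewrite hatE//; split=> [[_ [g Gg <-] rg]|[p [[g Gg pg] pr]]].
  have [p pg pr] := rho_continuous (V_basis VG) (c_inj VG) (cE VG) Gg rg.
  by exists p; split; [exists g|apply/rho_basicP].
exists (rho (cs G) g); first by exists g.
by move/(rho_basicP _ _ VG): pr; apply.
Qed.

Lemma borel_hat : borel_on V hat.
Proof.
apply: borel_on_effros => r; exists [set G : Effros Sinfty |
    exists p, hits G p /\ forall ab, ab \in r -> moves G p ab.1 ab.2].
  apply: measurable_exP => p; apply: measurable_andP;
    first exact: measurable_hits.
  apply: measurable_allP => ab; apply: measurable_impP;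
    first exact: measurable_cstP.
  by apply: (@measurable_moves _ _ id); exact: measurable_id.
by move=> G VG; exact: hits_hat.
Qed.

Hypothesis N_inv : forall (G H : Effros Sinfty) (phi : Sinfty -> Sinfty),
  V G -> V H -> top_iso G H phi ->
  forall U, open_subgroup G U -> (N G U <-> N H (phi @` U)).

Lemma iso_permutation (G H : Effros Sinfty) phi :
  V G -> V H -> top_iso G H phi ->
  exists alpha : Sinfty, (forall a, cs H (perm_fun alpha a) = phi @` cs G a) /\
     conj_set alpha (hat G) = hat H.
Proof.
move=> VG VH isophi; have [sG _ oG _] := V_basis VG;
  have [_ _ oH _] := V_basis VH.
have [psi [isopsi phiK psiK]] := top_iso_sym sG isophi.
have [[phiH _ _] phiM _ _] := isophi; have [[psiG _ _] psiM _ _] := isopsi.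
rewrite !hatE//.
apply: (iso_conj (V_basis VG) (c_inj VG) (cE VG) (V_basis VH) (c_inj VH) (cE VH)
  phiH psiG phiK psiK phiM psiM).
- by move=> U NU; apply/(N_inv VG VH isophi) => //; exact: oG.
- by move=> U NU; apply/(N_inv VH VG isopsi) => //; exact: oH.
Qed.

Lemma conj_intertwiner (G H : Effros Sinfty) alpha : V G -> V H ->
  conj_set alpha (hat G) = hat H ->
  exists2 phi, top_iso G H phi & forall g, (G : set Sinfty) g ->
    (H : set Sinfty) (phi g) /\
    rho (cs H) (phi g) = alpha * rho (cs G) g * alpha^-1.
Proof.
move=> VG VH; rewrite !hatE// => GH.
exact: (conj_iso (V_basis VG) (c_inj VG) (cE VG)
  (V_basis VH) (c_inj VH) (cE VH)).
Qed.

Lemma hat_reduction :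
  borel_reduction V top_isomorphic closed_subgroups conjugate hat.
Proof.
split; [exact: borel_hat|exact: hat_closed_subgroup|].
move=> G H VG VH.
split=> [[phi /(iso_permutation VG VH)[alpha [_ GH]]]|[alpha GH]].
  by exists alpha.
by have [phi isophi _] := conj_intertwiner VG VH GH; exists phi.
Qed.

Local Notation iso_triple :=
  (Effros Sinfty * Effros Sinfty * Effros (Sinfty * Sinfty)%type)%type.

Definition iso_triples : set iso_triple :=
  [set t : iso_triple | [/\ V t.1.1, V t.1.2 & is_iso_graph t.1.1 t.1.2 t.2]].

(** The isomorphism [phi] with graph [t.2] maps the coset [a] of the first
    group to the coset [b] of the second. The coset [a] is a union of traces on
    the group of basic open sets, so the graph meets the product of this coset
    and [basic q] if and only if it meets the product of one such [basic p] and
    [basic q]. *)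
Definition sends (t : iso_triple) a b := forall q,
  (exists p, (forall r, hits t.1.1 (p ++ r) -> hits (c a t.1.1) r) /\
     hits2 t.2 p q)
  <-> hits (c b t.1.2) q.

Lemma measurable_sends a b : measurable [set t | sends t a b].
Proof.
have m1 : measurable_fun setT (fun t : iso_triple => t.1.1).
  exact: measurableT_comp measurable_fst measurable_fst.
have m2 : measurable_fun setT (fun t : iso_triple => t.1.2).
  exact: measurableT_comp measurable_snd measurable_fst.
apply: measurable_allP => q; apply: measurable_iffP; last first.
  by apply: measurable_hitsT; exact: measurableT_comp (c_measurable b) m2.
apply: measurable_exP => p; apply: measurable_andP.
  apply: measurable_allP => r; apply: measurable_impP;
    first exact: measurable_hitsT.
  by apply: measurable_hitsT; exact: measurableT_comp (c_measurable a) m1.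
have /= := @measurable_snd _ _ (Effros Sinfty * Effros Sinfty)%type
  (Effros (Sinfty * Sinfty)%type) measurableT _ (measurable_hits2 p q).
by rewrite setTI.
Qed.

Lemma sendsP (t : iso_triple) phi alpha a b : V t.1.1 -> V t.1.2 ->
  t.2 = [set (x, phi x) | x in (t.1.1 : set Sinfty)] :> set (Sinfty * Sinfty) ->
  (forall a, cs t.1.2 (perm_fun alpha a) = phi @` cs t.1.1 a) ->
  sends t a b <-> perm_fun alpha a = b.
Proof.
case: t => [[G H] D] /= VG VH DE alphaP.
have [sG cG oG _] := V_basis VG.
have Ca : coset_of_basis G (N G) (cs G a) by apply/cE => //; exists a.
have ca_sub : cs G a `<=` (G : set Sinfty).
  have [g [U [Gg NU ->]]] := Ca; move=> _ [u Uu <-]; apply: subgroupM => //.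
  by have [_ + _] := oG U NU; apply.
have key q :
    (exists p, (forall r, hits G (p ++ r) -> hits (c a G) r) /\ hits2 D p q)
    <-> hits (c (perm_fun alpha a) H) q.
  rewrite -[X in hits X q]/(cs H (perm_fun alpha a)) alphaP; split.
    rewrite DE => -[p [pa [_ [x Gx <-] /= [px qx]]]]; exists (phi x) => //.
    exists x => //; apply: (closed_SinftyP _).1 (@closed_effros _ (c a G)) _ _.
    by move=> r rx; apply: pa; exists x => //; exact/basic_cat.
  move=> [_ [x ax <-] qx].
  have [p px pa] := coset_inner_basic sG oG Ca ax.
  exists p; split=> [r [y Gy /basic_cat[py ry]]|]; first by exists y => //;
    exact: pa.
  by rewrite DE; exists (x, phi x) => //; exists x => //; exact: ca_sub.
split=> [s|<- q]; last exact: key.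
apply: (c_inj VH); congr effros_set; apply: effros_hitsP => q.
by rewrite -key; exact: s.
Qed.

Definition conjugator (t : iso_triple) : Borel Sinfty := xget (1 : Sinfty)
  [set alpha : Sinfty | conj_set alpha (hat t.1.1) = hat t.1.2 /\
     forall a b, sends t a b <-> perm_fun alpha a = b].

Lemma conjugatorP t : iso_triples t ->
  conj_set (conjugator t) (hat t.1.1) = hat t.1.2 /\
  forall a b, sends t a b <-> perm_fun (conjugator t) a = b.
Proof.
move=> [VG VH [phi isophi DE]]; rewrite /conjugator.
have [alpha [alphaP GH]] := iso_permutation VG VH isophi.
case: xgetP => [_ _ //|/(_ alpha)[]]; split=> // a b.
exact: sendsP DE alphaP.
Qed.

Lemma borel_conjugator : borel_on iso_triples conjugator.
Proof.
apply: borel_on_Sinfty => a b; exists [set t | sends t a b].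
  exact: measurable_sends.
by move=> t /conjugatorP[_ tP]; rewrite -tP.
Qed.

Local Notation conj_triple :=
  (Effros Sinfty * Effros Sinfty * Borel Sinfty)%type.

Definition conj_triples : set conj_triple :=
  [set t : conj_triple |
     [/\ V t.1.1, V t.1.2 & conj_set t.2 (hat t.1.1) = hat t.1.2]].

(** For the isomorphism [phi] induced by [t.2], some [g] in [basic p] has its
    image in [basic q]. As [rho] is a homeomorphism onto its image, [phi g] is
    in [basic q] if and only if there is [r] such that [rho (phi g)], the
    conjugate of [rho g] by [t.2], is in [basic r] and [rho] maps no element of
    the second group outside of [basic q] into [basic r]. *)
Definition transports (t : conj_triple) p q :=
  exists r : seq (nat * nat), exists p',
  (forall p'', hits t.1.2 p'' ->
     (forall ab, ab \in r -> moves t.1.2 p'' ab.1 ab.2) ->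
     hits t.1.2 (p'' ++ q)) /\
  (hits t.1.1 (p ++ p') /\ forall ab, ab \in r -> exists a, exists b,
     (perm_fun t.2 a = ab.1 /\ perm_fun t.2 b = ab.2) /\
     moves t.1.1 (p ++ p') a b).

Lemma measurable_transports p q : measurable [set t | transports t p q].
Proof.
have m1 : measurable_fun setT (fun t : conj_triple => t.1.1).
  exact: measurableT_comp measurable_fst measurable_fst.
have m2 : measurable_fun setT (fun t : conj_triple => t.1.2).
  exact: measurableT_comp measurable_snd measurable_fst.
have m3 a b : measurable [set t : conj_triple | perm_fun t.2 a = b].
  have mb : measurable ([set g | perm_fun g a = b] : set (Borel Sinfty)).
    suff oU : open ([set g | perm_fun g a = b] : set Sinfty).
      exact: sub_sigma_algebra.
    rewrite openE => g gab; apply/nbhs_SinftyP; exists [:: (a, b)].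
      by rewrite /basic /= gab eqxx.
    by move=> h /basicP; apply; rewrite mem_head.
  have /= := @measurable_snd _ _ (Effros Sinfty * Effros Sinfty)%type
    (Borel Sinfty) measurableT _ mb.
  by rewrite setTI.
apply: measurable_exP => r; apply: measurable_exP => p'; apply: measurable_andP.
  apply: measurable_allP => p''; apply: measurable_impP;
    first exact: measurable_hitsT.
  apply: measurable_impP; last exact: measurable_hitsT.
  apply: measurable_allP => ab; apply: measurable_impP;
    first exact: measurable_cstP.
  exact: measurable_moves m2.
apply: measurable_andP; first exact: measurable_hitsT.
apply: measurable_allP => ab; apply: measurable_impP;
  first exact: measurable_cstP.
apply: measurable_exP => a; apply: measurable_exP => b; apply: measurable_andP.
  exact: measurable_andP.
exact: measurable_moves m1.
Qed.

Lemma transportsP (t : conj_triple) phi p q : V t.1.1 -> V t.1.2 ->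
  (forall g, (t.1.1 : set Sinfty) g -> (t.1.2 : set Sinfty) (phi g) /\
    rho (cs t.1.2) (phi g) = t.2 * rho (cs t.1.1) g * t.2^-1) ->
  hits2 [set (x, phi x) | x in (t.1.1 : set Sinfty)] p q <-> transports t p q.
Proof.
case: t => [[G H] alpha] /= VG VH phiP.
have movesV P (r : seq (nat * nat)) :
   (forall ab, ab \in r -> exists a, exists b,
     (perm_fun alpha a = ab.1 /\ perm_fun alpha b = ab.2) /\ moves G P a b) <->
   forall ab, ab \in relabel alpha^-1 r -> moves G P ab.1 ab.2.
  split=> [rP _ /mapP[ab abr ->] /=|rP ab abr].
    by have [a [b [[<- <-] mab]]] := rP _ abr; rewrite !perm_funK.
  exists (perm_fun alpha^-1 ab.1), (perm_fun alpha^-1 ab.2).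
  rewrite !perm_funVK; split=> //.
  by apply: (rP (_, _)); apply/mapP; exists ab.
split=> [[_ [g Gg <-] /= [pg qg]]|[r [p' /= [rq [pp' /movesV rp]]]]].
  have [Hg rg] := phiP g Gg.
  have [r rr rq] := rho_open (V_basis VH) (c_inj VH) (cE VH) Hg qg.
  move: rr; rewrite rg => /basic_relabelV rr.
  have [p' p'g p'r] := rho_continuous (V_basis VG) (c_inj VG) (cE VG) Gg rr.
  exists r, p'; split=> /=.
    move=> p'' [h Hh p''h] /(rho_basicP _ _ VH) p''r; exists h => //.
    by apply/basic_cat; split=> //; apply: rq => //; exact: p''r.
  split; first by exists g => //; exact/basic_cat.
  apply/movesV/(rho_basicP _ _ VG) => h Gh /basic_cat[_]; exact: p'r.
have [g Gg pg] := pp'; have [Hg rg] := phiP g Gg.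
exists (g, phi g); first by exists g.
split=> /=; first by have /basic_cat[] := pg.
move/(rho_basicP _ _ VG): rp => /(_ g Gg pg) rg'.
have {rg'} : basic r (rho (cs H) (phi g)) by rewrite rg; exact/basic_relabelV.
move=> rg'; apply/basicP => x y xyq.
have [p'' p''g p''r] := rho_continuous (V_basis VH) (c_inj VH) (cE VH) Hg rg'.
have [||h Hh] := rq ((x, perm_fun (phi g) x) :: p'').
- by exists (phi g) => //; rewrite /basic /= eqxx.
- apply/(rho_basicP _ _ VH) => h Hh p''h; apply: p''r => //.
  by apply: basic_sub p''h => z zp; rewrite inE zp orbT.
rewrite basic_cat => -[/basicP xh /basicP qh].
by rewrite -(qh _ _ xyq); apply/esym/xh; rewrite mem_head.
Qed.

Lemma closed_intertwiner_graph (t : conj_triple) phi : V t.1.1 -> V t.1.2 ->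
  (forall g, (t.1.1 : set Sinfty) g -> (t.1.2 : set Sinfty) (phi g) /\
    rho (cs t.1.2) (phi g) = t.2 * rho (cs t.1.1) g * t.2^-1) ->
  closed [set (x, phi x) | x in (t.1.1 : set Sinfty)].
Proof.
case: t => [[G H] alpha] /= VG VH phiP [x y] xy.
have near p q : basic p x -> basic q y -> exists g,
    [/\ (G : set Sinfty) g, basic p g & basic q (phi g)].
  move=> px qy; have [|_ [[g Gg <-] [pg qg]]] :=
    xy [set z : Sinfty * Sinfty | basic p z.1 /\ basic q z.2].
    by apply: open_nbhs_nbhs; split; [exact: open_basic2|].
  by exists g.
have Gx : (G : set Sinfty) x.
  apply: (closed_SinftyP _).1 (@closed_effros _ G) _ _ => p px.
  by have [//|g [Gg pg _]] := near p [::] px; exists g.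
exists x => //; congr (_, _); apply: perm_extP => a.
have [|p px pa] := intertwiner_basic (V_basis VG) (c_inj VG) (cE VG)
  (V_basis VH) (c_inj VH) (cE VH) phiP (q := graph_on [:: a] (phi x)) Gx.
  exact/basic_graph_on.
have [|g [Gg pg /basic_graph_on ga]] := near p (graph_on [:: a] y) px.
  exact/basic_graph_on.
have /basic_graph_on gx := pa g Gg pg.
by rewrite -ga ?mem_head// gx ?mem_head.
Qed.

Definition iso_graph (t : conj_triple) : Effros (Sinfty * Sinfty)%type :=
  xget point [set D : Effros (Sinfty * Sinfty)%type |
    is_iso_graph t.1.1 t.1.2 D /\ forall p q, hits2 D p q <-> transports t p q].

Lemma iso_graphP t : conj_triples t ->
  is_iso_graph t.1.1 t.1.2 (iso_graph t) /\
  forall p q, hits2 (iso_graph t) p q <-> transports t p q.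
Proof.
move=> [VG VH GH]; rewrite /iso_graph.
have [phi isophi phiP] := conj_intertwiner VG VH GH.
have cphi := closed_intertwiner_graph VG VH phiP.
case: xgetP => [_ _ //|/(_ (mk_effros cphi))[]]; split; first by exists phi.
by move=> p q; exact: transportsP.
Qed.

Lemma borel_iso_graph : borel_on conj_triples iso_graph.
Proof.
apply: borel_on_effros2 => p q; exists [set t | transports t p q].
  exact: measurable_transports.
by move=> t /iso_graphP[_ tP]; exact: tP.
Qed.

End reduction.

(** * Orbital structures *)

(** The relation of index [n] has arity [2 n]: it relates two [n]-tuples. *)
Definition orbital_language : language :=
  @Language nat (fun n => n + n)%N void (fun=> 0%N).

Local Notation rel_index := {n : nat & (n + n).-tuple nat}.

(** There are no function symbols, so only the finitely many values of the
    relations in a neighbourhood matter. *)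
Lemma nbhs_structure (M : structures orbital_language) A : nbhs M A ->
  exists s : seq rel_index, forall M' : structures orbital_language,
    (forall x, x \in s -> M'.1 (tag x) (tagged x) = M.1 (tag x) (tagged x)) ->
    A M'.
Proof.
move=> [[P Q] /= [MP MQ] PQA].
pose K (n : nat) := {ptws (n + n).-tuple nat -> bool}.
pose F : set_system (prod_topology K) := [set P : set (prod_topology K) |
  exists s : seq rel_index, forall M', (forall x, x \in s ->
    M' (tag x) (tagged x) = M.1 (tag x) (tagged x)) -> P M'].
have FF : Filter F.
  split; first by exists [::].
  - move=> P1 P2 [s1 sP1] [s2 sP2]; exists (s1 ++ s2) => M' M'P; split.
      by apply: sP1 => x xs; apply: M'P; rewrite mem_cat xs.
    by apply: sP2 => x xs; apply: M'P; rewrite mem_cat xs orbT.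
  - by move=> P1 P2 P12 [s sP]; exists s => M' /sP/P12.
have [s sP] : F P.
  move: P MP {PQA}; rewrite -/(_ `<=` F).
  apply: (@prod_topology_cvg nat K F M.1) => n.
  apply: (@prod_topology_cvg ((n + n).-tuple nat) (fun=> bool)) => t W MW.
  exists [:: Tagged (fun n => (n + n).-tuple nat) t] => M'.
  move=> /(_ _ (mem_head _ _)) /= M't.
  by rewrite /= M't; exact: nbhs_singleton MW.
exists s => M' /sP PM'; apply: PQA; split=> //=.
rewrite (_ : M'.2 = M.2); first exact: nbhs_singleton MQ.
by apply: functional_extensionality_dep => -[].
Qed.

Lemma borel_on_structures d (X : measurableType d) (D : set X)
    (f : X -> Borel (structures orbital_language)) :
  (forall n (t : (n + n).-tuple nat), exists2 A, measurable A &
     forall x, D x -> (f x).1 n t <-> A x) ->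
  borel_on D f.
Proof.
move=> Hf; apply: (@borel_on_base _ _ X (Borel (structures orbital_language))
  (@open (structures orbital_language)) (seq (rel_index * bool))
  (fun s =>
    [set M | forall x, x \in s -> M.1 (tag x.1) (tagged x.1) = x.2])) => //.
  move=> U M oU UM; have [s sU] : exists s : seq rel_index,
      forall M' : structures orbital_language,
      (forall x, x \in s -> M'.1 (tag x) (tagged x) = M.1 (tag x) (tagged x)) ->
      U M'.
    by apply: nbhs_structure; exact: open_nbhs_nbhs.
  exists [seq (x, M.1 (tag x) (tagged x)) | x <- s].
    by move=> _ /mapP[x _ ->].
  move=> M' M'P; apply: sU => x xs.
  by apply: (M'P (_, _)); apply/mapP; exists x.
elim=> [|[x b] s [A mA AP]]; first by exists setT.
have [B mB BP] := Hf (tag x) (tagged x).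
exists [set y | (B y <-> b) /\ A y].
  apply: measurable_andP => //.
  by apply: measurable_iffP => //; exact: measurable_cstP.
move=> y Dy /=; rewrite -BP// -AP//; split=> [yP|[yb yP] z].
  split; first by rewrite (yP (x, b)) ?mem_head.
  by move=> z zs; apply: yP; rewrite inE zs orbT.
by rewrite inE => /orP[/eqP->/=|/yP//]; apply/idP/idP => /yb.
Qed.

Definition tuple_graph n (t : (n + n).-tuple nat) : seq (nat * nat) :=
  zip (take n t) (drop n t).

Definition orbital (G : Effros Sinfty) : Borel (structures orbital_language) :=
  ((fun n t => `[< hits G (tuple_graph t) >]),
   (fun f : void => match f with end)).

Lemma tuple_graph_ex r :
  exists n, exists t : (n + n).-tuple nat, tuple_graph t = r.
Proof.
have st : size (unzip1 r ++ unzip2 r) == (size r + size r)%N.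
  by rewrite size_cat !size_map.
exists (size r), (Tuple st); rewrite /tuple_graph /=.
by rewrite take_size_cat ?drop_size_cat ?size_map// zip_unzip.
Qed.

Lemma tuple_graph_map n (t : (n + n).-tuple nat) (alpha : Sinfty) :
  tuple_graph (map_tuple (perm_fun alpha) t) = relabel alpha (tuple_graph t).
Proof.
rewrite /tuple_graph /relabel /= -map_take -map_drop.
by elim: (take n t) (drop n t) => [|a s IHs] [|b s'] //=; rewrite IHs.
Qed.

(** Closed sets of permutations are determined by the basic open sets that they
    meet, and the relations of the structure list these. *)
Lemma orbital_iso (G H : Effros Sinfty) :
  struct_iso (orbital G) (orbital H) <-> conjugate G H.
Proof.
split=> [[s [sbij sR _]]|[alpha /conj_set_eqP GH]].
  exists (mk_perm sbij); apply/conj_set_eqP => r.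
  have [n [t <-]] := tuple_graph_ex r.
  rewrite -tuple_graph_map; have /= e := sR n t.
  by split=> /asboolP h; apply/asboolP; [rewrite -e|rewrite e].
exists (perm_fun alpha); split=> [|n t|[]]; first exact: perm_fun_bij.
by apply: asbool_equiv_eq; rewrite tuple_graph_map.
Qed.

Lemma borel_orbital d (X : measurableType d) (D : set X)
    (f : X -> Effros Sinfty) :
  borel_on D f -> borel_on D (orbital \o f).
Proof.
move=> bf; apply: borel_on_structures => n t.
have [A mA DA] := bf _ (measurable_hits (tuple_graph t)).
exists A => // x Dx /=; split=> [/asboolP h|Ax].
  suff : (D `&` A) x by case.
  by rewrite -DA.
apply/asboolP.
suff : (D `&` f @^-1` [set E | hits E (tuple_graph t)]) x by case.
by rewrite DA.
Qed.

Theorem theorem3p1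
    (V : set (Effros Sinfty))
    (N : Effros Sinfty -> set (set Sinfty))
    (V_sub : V `<=` closed_subgroups)
    (V_borel : measurable V)
    (V_conj : forall (G H : Effros Sinfty) (a : Sinfty),
       V G -> conj_set a G = H -> V H)
    (N_count : forall G, V G -> (N G #= [set: nat])%card)
    (N_open : forall G U, V G -> N G U -> open_subgroup G U)
    (N_basis : forall G, V G -> nbhd_basis1 G (N G))
    (T_borel : measurable
       [set p : Effros Sinfty * Effros Sinfty | V p.1 /\ N p.1 p.2])
    (T_inv : forall (G H : Effros Sinfty) (phi : Sinfty -> Sinfty),
       V G -> V H -> top_iso G H phi ->
       forall U, open_subgroup G U -> (N G U <-> N H (phi @` U))) :
  (borel_reducible V top_isomorphic closed_subgroups conjugate /\
   exists hat : Effros Sinfty -> Effros Sinfty,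
     [/\ borel_reduction V top_isomorphic closed_subgroups conjugate hat,
       (exists conjugator :
            Effros Sinfty * Effros Sinfty * Effros (Sinfty * Sinfty)%type ->
            Borel Sinfty,
          let triples :=
            [set t : Effros Sinfty * Effros Sinfty *
                     Effros (Sinfty * Sinfty)%type |
              [/\ V t.1.1, V t.1.2 & is_iso_graph t.1.1 t.1.2 t.2]] in
          borel_on triples conjugator /\
          forall t, triples t ->
            conj_set (conjugator t) (hat t.1.1) = hat t.1.2) &
       (exists iso_graph :
            Effros Sinfty * Effros Sinfty * Borel Sinfty ->
            Effros (Sinfty * Sinfty)%type,
          let triples :=
            [set t : Effros Sinfty * Effros Sinfty * Borel Sinfty |
              [/\ V t.1.1, V t.1.2 &
                  conj_set t.2 (hat t.1.1) = hat t.1.2]] in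
          borel_on triples iso_graph /\
          forall t, triples t ->
            is_iso_graph t.1.1 t.1.2 (iso_graph t))]) /\
  classifiable_by_countable_structures V top_isomorphic.
Proof.
have V_group G : V G -> top_group_basis G (N G).
  by move=> VG; exact: (V_group_basis V_sub N_open N_basis VG).
have [c [mc cP]] := coset_enumeration V_sub N_count N_open T_borel.
have c_inj G (VG : V G) := (cP G VG).1.
have cE G (VG : V G) := (cP G VG).2.
have red := hat_reduction V_group mc c_inj cE T_inv.
split; last first.
  exists orbital_language, (orbital \o hat c); have [bh _ hE] := red.
  split=> [||G H VG VH]; [exact: borel_orbital|by []|].
  by rewrite orbital_iso; exact: hE.
split; first by exists (hat c).
exists (hat c); split => //.
- exists (conjugator c); split.
    exact: (borel_conjugator V_group mc c_inj cE T_inv).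
  by move=> t /(conjugatorP V_group c_inj cE T_inv)[].
- exists (iso_graph c); split.
    exact: (borel_iso_graph V_group mc c_inj cE).
  by move=> t /(iso_graphP V_group c_inj cE)[].
Qed.
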